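(* Let $\mathcal{F}:\mathcal{C}\to\Omega$ be a quasi-Fitting invariant. Then for any $n\in\mathbb{Z}$, the following map $\mathcal{F}^{\langle n\rangle}:\mathcal{C}\to\Omega$ is well-defined and, moreover, $\mathcal{F}^{\langle n\rangle}$ is again a quasi-Fitting invariant. (1) Suppose $n\ge0$. For each $M\in\mathcal{C}$, take an exact sequence \[ 0\to N\to P_1\to\dots\to P_n\to M\to0 \] in $\mathcal{C}$ with $P_1,\dots,P_n\in\mathcal{P}$ and define \[ \mathcal{F}^{\langle n\rangle}(M)=\left(\prod_{i=1}^n\mathcal{F}(P_i)^{(-1)^i}\right)\mathcal{F}(N). \] (2) Suppose $n<0$. For each $M\in\mathcal{C}$, take an exact sequence \[ 0\to M\to P_{-n}\to\dots\to P_1\to N\to0 \] in $\mathcal{C}$ with $P_1,\dots,P_{-n}\in\mathcal{P}$ and define \[ \mathcal{F}^{\langle n\rangle}(M)=\left(\prod_{i=1}^{-n}\mathcal{F}(P_i)^{(-1)^i}\right)\mathcal{F}(N). \]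
   Context: $R$ is a (not necessarily commutative) left and right noetherian ring with unity, and $S$ is an Ore set of $R$ consisting of non-zero-divisors: $1\in S$; $S$ is closed under multiplication; for $f\in S$, $a\in R$ one has $fR\cap aS\ne\emptyset$ and $Rf\cap Sa\ne\emptyset$. Put $E^i_R(M)=\mathrm{Ext}^i_R(M,R)$ and $\mathrm{pd}^\star_R(M)=\sup\{i\in\mathbb Z\mid E^i_R(M)\ne0\}$. It is assumed that there is an integer $d(R)$ with $\mathrm{pd}^\star_R(M)\le d(R)$ for every finitely generated left or right $R$-module $M$. $\mathcal M$ is the category of finitely generated $S$-torsion left $R$-modules ($S$-torsion: every element is annihilated by an element of $S$), $\mathcal C=\{M\in\mathcal M\mid\mathrm{pd}^\star_R(M)\le1\}$, $\mathcal P=\{P\in\mathcal M\mid\mathrm{pd}_R(P)\le1\}\subset\mathcal C$. A sequence is ''exact in $\mathcal C$'' if it is an exact sequence of $R$-modules which, when split into short exact sequences, has all terms (including the intermediate images) in $\mathcal C$. A quasi-Fitting invariant is a map $\mathcal F$ assigning to each object of $\mathcal C$ an element of a commutative monoid $\Omega$ such that: (i) $\mathcal F(P)\in\Omega^\times$ for $P\in\mathcal P$; (ii) if $0\to M'\to M\to P\to0$ is exact in $\mathcal C$ with $P\in\mathcal P$, then $\mathcal F(M)=\mathcal F(P)\mathcal F(M')$; (iii) if $0\to P\to M\to M'\to0$ is exact in $\mathcal C$ with $P\in\mathcal P$, then $\mathcal F(M)=\mathcal F(P)\mathcal F(M')$. ''Well-defined'' means that such an exact sequence exists for each $M$ and that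 the value does not depend on its choice. *)

(* Defs.v *)
From HB Require Import structures.
From mathcomp Require Import all_boot all_order all_algebra.
From mathcomp Require Import boolp classical_sets constructive_ereal.

Set Implicit Arguments.
Unset Strict Implicit.
Unset Printing Implicit Defensive.

Import Order.TTheory GRing.Theory Num.Theory.

Local Open Scope classical_set_scope.
Local Open Scope ring_scope.

(* Right R-modules are left modules over the converse ring R^c; accordingly
   right-handed notions are the left-handed ones taken over R^c. *)

Definition left_ideal (R : pzRingType) (I : set R) : Prop :=
  [/\ I 0, forall x y, I x -> I y -> I (x + y) & forall a x, I x -> I (a * x)].

Definition left_noetherian (R : pzRingType) : Prop :=
  forall I : set R, left_ideal I ->
    exists (n : nat) (a : 'I_n -> R),
      forall x, I x <-> exists c : 'I_n -> R, x = \sum_(i < n) c i * a i.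

Definition ore_set (R : pzRingType) (S : set R) : Prop :=
  [/\ forall f, S f -> GRing.lreg f /\ GRing.rreg f,
      S 1,
      forall f g, S f -> S g -> S (f * g) &
      forall f a, S f ->
        (exists b s, S s /\ f * b = a * s) /\
        (exists b s, S s /\ b * f = s * a)].

Definition finitely_generated (R : pzRingType) (M : lmodType R) : Prop :=
  exists (n : nat) (v : 'I_n -> M),
    forall x : M, exists c : 'I_n -> R, x = \sum_(i < n) c i *: v i.

Definition torsion (R : pzRingType) (S : set R) (M : lmodType R) : Prop :=
  forall x : M, exists s, S s /\ s *: x = 0.

Definition surj (A B : Type) (f : A -> B) : Prop := forall y, exists x, f x = y.

Definition exact_at (A B C : Type) (c0 : C) (f : A -> B) (g : B -> C) : Prop :=
  forall y, g y = c0 <-> exists x, f x = y.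

Definition projective (R : pzRingType) (P : lmodType R) : Prop :=
  forall (A B : lmodType R) (g : {linear A -> B}) (f : {linear P -> B}),
    surj g -> exists h : {linear P -> A}, forall x, g (h x) = f x.

Record proj_resolution (R : pzRingType) (M : lmodType R) := ProjResolution {
  res_obj : nat -> lmodType R;
  res_diff : forall i, {linear res_obj i.+1 -> res_obj i};
  res_aug : {linear res_obj 0%N -> M};
  res_proj : forall i, projective (res_obj i);
  res_surj : surj res_aug;
  res_exact0 : exact_at 0 (res_diff 0%N) res_aug;
  res_exactS : forall i, exact_at 0 (res_diff i.+1) (res_diff i) }.

(* The complex Hom_R(P_., N) attached to a projective resolution P_. of M. *)
Definition cocycle (R : pzRingType) (M N : lmodType R) (P : proj_resolution M)
    (i : nat) (f : {linear res_obj P i -> N}) : Prop :=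
  forall x, f (res_diff P i x) = 0.

Definition coboundary (R : pzRingType) (M N : lmodType R)
    (P : proj_resolution M) (i : nat) : {linear res_obj P i -> N} -> Prop :=
  match i with
  | 0 => fun f => forall x, f x = 0
  | j.+1 => fun f =>
      exists g : {linear res_obj P j -> N}, forall x, f x = g (res_diff P j x)
  end.

(* Ext^i_R(M, N) = H^i(Hom_R(P_., N)) is nonzero; as usual, this does not
   depend on the projective resolution P_. of M. *)
Definition Ext_neq0 (R : pzRingType) (i : nat) (M N : lmodType R) : Prop :=
  exists P : proj_resolution M, exists f : {linear res_obj P i -> N},
    cocycle f /\ ~ coboundary f.

(* The supremum and infimum are taken in the integers with -oo and +oo added.
   Ext^i vanishes for i < 0, so that only natural indices i contribute. *)
Definition pdstar (R : pzRingType) (M : lmodType R) : \bar int :=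
  supremum -oo%E [set (i%:Z)%:E | i in [set i : nat | Ext_neq0 i M R^o]].

Definition pd (R : pzRingType) (M : lmodType R) : \bar int :=
  infimum +oo%E [set (l%:Z)%:E | l in [set l : nat |
    exists P : proj_resolution M,
      forall i, (l < i)%N -> forall x : res_obj P i, x = 0]].

Definition in_M (R : pzRingType) (S : set R) (M : lmodType R) : Prop :=
  finitely_generated M /\ torsion S M.

Definition in_C (R : pzRingType) (S : set R) (M : lmodType R) : Prop :=
  in_M S M /\ (pdstar M <= 1%:E)%E.

Definition in_P (R : pzRingType) (S : set R) (M : lmodType R) : Prop :=
  in_M S M /\ (pd M <= 1%:E)%E.

Record objC (R : pzRingType) (S : set R) := ObjC {
  objC_mod :> lmodType R;
  objC_in : in_C S objC_mod }.

(* 0 -> A -> B -> C -> 0 is exact in the category of objC; its intermediate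
   images are isomorphic to A and C. *)
Definition short_exact (R : pzRingType) (S : set R) (A B C : objC S) : Prop :=
  exists (f : {linear A -> B}) (g : {linear B -> C}),
    [/\ injective f, exact_at 0 f g & surj g].

(* The image of f, presented as the middle term of an epi-mono factorization,
   is an object of objC. *)
Definition image_in_C (R : pzRingType) (S : set R) (A B : objC S)
    (f : {linear A -> B}) : Prop :=
  exists (I : objC S) (p : {linear A -> I}) (j : {linear I -> B}),
    [/\ surj p, injective j & forall x, f x = j (p x)].

(* Exact sequences 0 -> X_0 -> X_1 -> ... -> X_n -> X_n.+1 -> 0 of objC, all of
   whose images are in objC. The data at indices beyond n.+1 are unused. *)
Record exact_seq (R : pzRingType) (S : set R) (n : nat) := ExactSeq {
  es_obj :> nat -> objC S;
  es_map : forall i, {linear es_obj i -> es_obj i.+1};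
  es_inj : injective (es_map 0%N);
  es_exact : forall i, (i < n)%N -> exact_at 0 (es_map i) (es_map i.+1);
  es_surj : surj (es_map n);
  es_image : forall i, (i <= n)%N -> image_in_C (es_map i) }.

Local Open Scope group_scope.

Definition is_inverse (Omega : monoidType) (x y : Omega) : Prop :=
  x * y = 1 /\ y * x = 1.

Definition is_unit (Omega : monoidType) (x : Omega) : Prop :=
  exists y, is_inverse x y.

(* Only meaningful on units. *)
Definition unit_inv (Omega : monoidType) (x : Omega) : Omega :=
  xget 1 [set y | is_inverse x y].

(* x ^ ((-1) ^ i) *)
Definition exp_sign (Omega : monoidType) (i : nat) (x : Omega) : Omega :=
  if odd i then unit_inv x else x.

Definition quasi_fitting (R : pzRingType) (S : set R) (Omega : monoidType)
    (F : objC S -> Omega) : Prop :=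
  [/\ forall P : objC S, in_P S P -> is_unit (F P),
      forall M' M P : objC S, in_P S P -> short_exact M' M P ->
        F M = F P * F M' &
      forall P M M' : objC S, in_P S P -> short_exact P M M' ->
        F M = F P * F M'].

(* Sequences used to compute F^<n>(M), with m = |n|:
   - if n >= 0:  0 -> N -> P_1 -> ... -> P_m -> M -> 0,
     that is X_0 = N, X_i = P_i, X_m.+1 = M;
   - if n < 0:   0 -> M -> P_m -> ... -> P_1 -> N -> 0,
     that is X_0 = M, X_i = P_(m.+1 - i), X_m.+1 = N. *)
Definition shift_seq (R : pzRingType) (S : set R) (n : int) (M : objC S)
    (X : exact_seq S `|n|%N) : Prop :=
  (if (0 <= n)%R then X `|n|.+1%N else X 0%N) = M /\
  forall i, (1 <= i <= `|n|)%N -> in_P S (X i).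

Definition shift_value (R : pzRingType) (S : set R) (Omega : monoidType)
    (F : objC S -> Omega) (n : int) (X : exact_seq S `|n|%N) : Omega :=
  if (0 <= n)%R then
    (\big[*%g/1]_(1 <= i < `|n|.+1) exp_sign i (F (X i))) * F (X 0%N)
  else
    (\big[*%g/1]_(1 <= i < `|n|.+1) exp_sign i (F (X (`|n|.+1 - i)%N)))
      * F (X `|n|.+1%N).

Definition shift_well_defined (R : pzRingType) (S : set R) (Omega : monoidType)
    (F : objC S -> Omega) (n : int) : Prop :=
  forall M : objC S,
    (exists X : exact_seq S `|n|%N, shift_seq M X) /\
    (forall X Y : exact_seq S `|n|%N, shift_seq M X -> shift_seq M Y ->
       shift_value F X = shift_value F Y).

Definition shift (R : pzRingType) (S : set R) (Omega : monoidType)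
    (F : objC S -> Omega) (n : int) (M : objC S) : Omega :=
  xget 1 [set w | exists2 X : exact_seq S `|n|%N,
                    shift_seq M X & w = shift_value F X].

(* Main.v *)
(* A module M in C is covered by a sum P of modules R/Rs killing its generators,
   and the kernel is again in C. Dually M embeds into some P with cokernel in C:
   in a resolution F_i of M by free modules of finite rank, the dual complex is
   exact in degrees at least 2, so the bound d(R) for right modules makes the
   first syzygy of M reflexive; generators of the module of 1-cocycles, with a
   common Ore denominator t, then give an embedding M -> (R/Rt)^k inducing a
   surjection on Ext^1(-, R), whence Ext^2 of the cokernel vanishes.

   Two one-step sequences for M are compared through the pullback (n > 0) or the
   pushout (n < 0), to which rule (ii), respectively (iii), applies in two ways;
   so F^<1> and F^<-1> are well defined, and they are quasi-Fitting invariants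
   with value F(P)^-1 on P. The general case is obtained by iteration along the
   images of an exact sequence. *)

Require Import Defs.
From HB Require Import structures.
From mathcomp Require Import all_boot all_order all_algebra.
From mathcomp Require Import boolp classical_sets constructive_ereal.

Set Implicit Arguments.
Unset Strict Implicit.
Unset Printing Implicit Defensive.

Import Order.TTheory GRing.Theory Num.Theory.

Local Open Scope classical_set_scope.
Local Open Scope ring_scope.

(** Ext enters only through its vanishing, so no Ext group is built: Ext^1(A, N) = 0 means that maps
    into N extend along every short exact sequence ending in A, higher vanishing is dimension
    shifting, and three fragments of the long exact sequence suffice. The hard point is the
    embedding of M: injective modules are no help, since the target must be finitely generated,
    torsion and of projective dimension at most 1. Dualizing a free resolution leads to right
    modules, hence the matrices and the passage to R^c. For F^<-1>, rule (iii) brings in the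
    cokernel Y of an injection between objects of P, whose projective dimension is a priori only at
    most 2; membership of Y in C, through Ext^2(Y, R) = 0, brings it back to 1. *)

Definition submodule (R : pzRingType) (M : lmodType R) (N : set M) : Prop :=
  N 0 /\ forall a x y, N x -> N y -> N (a *: x + y).

(** * Submodules *)

Section Submodule.
Variables (R : pzRingType) (M : lmodType R) (N : set M).

(** The set becomes a boolean predicate with [hN] as an argument, so that the closure instance, and
    with it the module structure on the subtype, can be declared for it. *)
Definition submodule_pred (hN : submodule N) : {pred M} := fun x => `[< N x >].

Variable hN : submodule N.

Lemma submodule_pred_closed : GRing.submod_closed (submodule_pred hN).
Proof.
split; first by apply/asboolP; case: hN.
by move=> a x y /asboolP Nx /asboolP Ny; apply/asboolP; case: hN => _; apply.
Qed.

HB.instance Definition _ :=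
  GRing.isSubmodClosed.Build R M (submodule_pred hN) submodule_pred_closed.

Definition submodule_type := {x : M | x \in submodule_pred hN}.
HB.instance Definition _ := SubChoice.on submodule_type.
HB.instance Definition _ := [SubChoice_isSubLmodule of submodule_type by <:].

Lemma submodule_embedding : exists (K : lmodType R) (i : {linear K -> M}),
  injective i /\ forall x, N x <-> exists k, i k = x.
Proof.
exists (submodule_type : lmodType R), (val : {linear submodule_type -> M}).
split; first exact: val_inj.
move=> x; split=> [Nx|[k <-]].
  have h : x \in submodule_pred hN by apply/asboolP.
  by exists (Sub x h : submodule_type); exact: SubK.
by have /asboolP := valP k.
Qed.

End Submodule.

(** * Linear maps from relations and factorizations *)

Section LinearMaps.
Variable R : pzRingType.
Implicit Types A B C K L M : lmodType R.

Lemma linear_bundle A B (f : A -> B) :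
  (forall a x y, f (a *: x + y) = a *: f x + f y) ->
  exists g : {linear A -> B}, forall x, g x = f x.
Proof.
move=> hf.
pose l := GRing.isLinear.Build R A B *:%R f hf.
by exists (HB.pack f l : {linear A -> B}).
Qed.

(** Two values at a point differ by a value at 0, so [r] is the graph of a map, and that map is
    linear. Maps into pullbacks and out of quotients are specified this way. *)
Lemma linear_of_relation A B (r : A -> B -> Prop) :
  (forall a, exists b, r a b) -> (forall b, r 0 b -> b = 0) ->
  (forall k a a' b b', r a b -> r a' b' -> r (k *: a + a') (k *: b + b')) ->
  exists f : {linear A -> B}, forall a, r a (f a).
Proof.
move=> /choice[f hf] h0 hD.
have uniq a b b' : r a b -> r a b' -> b = b'.
  move=> h h'; have := hD (-1) _ _ _ _ h' h.
  by rewrite !scaleN1r addNr => /h0 /eqP; rewrite addrC subr_eq0 => /eqP.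
have [|g hg] := @linear_bundle A B f.
  by move=> k x y; apply: uniq (hf _) _; apply: hD.
by exists g => a; rewrite hg.
Qed.

Lemma factor_injective A M K (g : {linear A -> M}) (i : {linear K -> M}) :
  injective i -> (forall a, exists k, i k = g a) ->
  exists f : {linear A -> K}, forall a, i (f a) = g a.
Proof.
move=> inj h; apply: (@linear_of_relation A K (fun a k => i k = g a)) => //.
- by move=> b; rewrite linear0 => hb; apply: inj; rewrite hb linear0.
- by move=> k a a' b b' hb hb'; rewrite !linearP hb hb'.
Qed.

Lemma factor_surjective M (Q : lmodType R) B (p : {linear M -> Q}) (g : {linear M -> B}) :
  surj p -> (forall x, p x = 0 -> g x = 0) ->
  exists f : {linear Q -> B}, forall x, f (p x) = g x.
Proof.
move=> sp h.
have [|||f hf] := @linear_of_relation Q B (fun q b => exists2 x, p x = q & g x = b).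
- by move=> q; have [x hx] := sp q; exists (g x), x.
- by move=> b [x /h px <-].
- move=> k q q' b b' [x <- <-] [x' <- <-].
  by exists (k *: x + x'); rewrite linearP.
exists f => x; have [y py <-] := hf (p x).
have := h (y - x); rewrite !linearB py subrr => /(_ erefl) /eqP.
by rewrite subr_eq0 => /eqP.
Qed.

End LinearMaps.

(** * Quotient modules *)

Section Quotient.
Variables (R : pzRingType) (M : lmodType R) (N : set M).

(** The representative is chosen from the coset as a set: congruent elements have equal cosets,
    hence equal representatives, and the quotient is the subtype of the fixed points. *)
Definition quotient_repr (hN : submodule N) (x : M) : M :=
  xget 0 [set y | N (y - x)].

Variable hN : submodule N.
Local Notation rp := (quotient_repr hN).

Lemma submodule_zmod x y : N x -> N y -> N (x - y).
Proof. by move=> Nx Ny; case: hN => _ h; rewrite addrC -scaleN1r; apply: h. Qed.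

Lemma quotient_reprP x : N (rp x - x).
Proof.
by apply: (@xgetPex _ 0 [set y | N (y - x)]); exists x; rewrite /= subrr; case: hN.
Qed.

Lemma quotient_repr_eq x y : rp x = rp y <-> N (x - y).
Proof.
split=> [e|Nxy].
  have := submodule_zmod (quotient_reprP y) (quotient_reprP x).
  by rewrite e opprB addrC addrA subrK.
congr (xget _ _); apply/seteqP; split=> z /= h.
- case: hN => _ hD; have := hD 1 _ _ h Nxy.
  by rewrite scale1r addrA subrK.
- by have := submodule_zmod h Nxy; rewrite opprB addrA subrK.
Qed.

Lemma quotient_reprK x : rp (rp x) = rp x.
Proof. by apply/quotient_repr_eq/quotient_reprP. Qed.

Definition quotient_type := {x : M | rp x == x}.
HB.instance Definition _ := Choice.on quotient_type.

Definition quotient_proj (x : M) : quotient_type :=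
  exist _ (rp x) (introT eqP (quotient_reprK x)).
Local Notation pr := quotient_proj.

Lemma quotient_proj_eq x y : pr x = pr y <-> N (x - y).
Proof.
rewrite -quotient_repr_eq; split=> [/(congr1 val)//|e].
exact: val_inj.
Qed.

Lemma quotient_projK (q : quotient_type) : pr (val q) = q.
Proof. by apply: val_inj; exact: eqP (valP q). Qed.

Lemma quotient_proj_repr x : N (val (pr x) - x).
Proof. exact: quotient_reprP. Qed.

Definition quotient_add (p q : quotient_type) := pr (val p + val q).
Definition quotient_opp (p : quotient_type) := pr (- val p).
Definition quotient_scale (a : R) (p : quotient_type) := pr (a *: val p).

Lemma submodule_add x y : N x -> N y -> N (x + y).
Proof. by case: hN => _ h Nx; rewrite -[x]scale1r; apply: h. Qed.

Lemma submodule_scale a x : N x -> N (a *: x).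
Proof. by case: hN => h0 h Nx; rewrite -[a *: x]addr0; apply: h. Qed.

Lemma quotient_projD x y : quotient_add (pr x) (pr y) = pr (x + y).
Proof.
apply/quotient_proj_eq; rewrite opprD addrACA.
by apply: submodule_add; exact: quotient_proj_repr.
Qed.

Lemma quotient_projN x : quotient_opp (pr x) = pr (- x).
Proof.
apply/quotient_proj_eq; rewrite -opprD -[- (_ + _)]scaleN1r.
by apply: submodule_scale; exact: quotient_proj_repr.
Qed.

Lemma quotient_projZ a x : quotient_scale a (pr x) = pr (a *: x).
Proof.
apply/quotient_proj_eq; rewrite -scalerBr.
by apply: submodule_scale; exact: quotient_proj_repr.
Qed.

Fact quotient_addA : associative quotient_add.
Proof.
move=> p q r; rewrite -(quotient_projK p) -(quotient_projK q) -(quotient_projK r).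
by rewrite !quotient_projD addrA.
Qed.

Fact quotient_addC : commutative quotient_add.
Proof. by move=> p q; rewrite /quotient_add addrC. Qed.

Fact quotient_add0 : left_id (pr 0) quotient_add.
Proof. by move=> p; rewrite -(quotient_projK p) quotient_projD add0r. Qed.

Fact quotient_addN : left_inverse (pr 0) quotient_opp quotient_add.
Proof.
by move=> p; rewrite -(quotient_projK p) quotient_projN quotient_projD addNr.
Qed.

HB.instance Definition _ := GRing.isZmodule.Build quotient_type
  quotient_addA quotient_addC quotient_add0 quotient_addN.

Fact quotient_scaleA a b p :
  quotient_scale a (quotient_scale b p) = quotient_scale (a * b) p.
Proof. by rewrite -(quotient_projK p) !quotient_projZ scalerA. Qed.

Fact quotient_scale1 : left_id 1 quotient_scale.
Proof. by move=> p; rewrite -(quotient_projK p) !quotient_projZ scale1r. Qed.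

Fact quotient_scaleDr : right_distributive quotient_scale +%R.
Proof.
move=> a p q; rewrite -(quotient_projK p) -(quotient_projK q).
by rewrite [X in quotient_scale _ X]quotient_projD !quotient_projZ
  [RHS]quotient_projD scalerDr.
Qed.

Fact quotient_scaleDl p : {morph quotient_scale^~ p : a b / a + b}.
Proof.
move=> a b; rewrite -(quotient_projK p) !quotient_projZ.
by rewrite [RHS]quotient_projD scalerDl.
Qed.

HB.instance Definition _ := GRing.Zmodule_isLmodule.Build R quotient_type
  quotient_scaleA quotient_scale1 quotient_scaleDr quotient_scaleDl.

Lemma quotient_map : exists (Q : lmodType R) (p : {linear M -> Q}),
  surj p /\ forall x, p x = 0 <-> N x.
Proof.
exists (quotient_type : lmodType R).
have [|p hp] := @linear_bundle R M (quotient_type : lmodType R) quotient_proj.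
  by move=> a x y; rewrite -quotient_projD -quotient_projZ.
exists p; split=> [q|x]; first by exists (val q); rewrite hp quotient_projK.
rewrite hp -[x in N x]subr0 -quotient_proj_eq; split=> ->//.
Qed.

End Quotient.

(** * Short exact sequences, pullbacks and pushouts *)

Section ExactSequences.
Variable R : pzRingType.
Implicit Types A B C K L M N P Q X : lmodType R.

Definition ses A B C (f : {linear A -> B}) (g : {linear B -> C}) : Prop :=
  [/\ injective f, exact_at 0 f g & surj g].

Lemma linear_injective A B (f : {linear A -> B}) :
  (forall x, f x = 0 -> x = 0) -> injective f.
Proof.
move=> h x y e; apply/eqP; rewrite -subr_eq0; apply/eqP/h.
by rewrite linearB e subrr.
Qed.

Lemma exact_comp0 A B C (f : {linear A -> B}) (g : {linear B -> C}) x :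
  exact_at 0 f g -> g (f x) = 0.
Proof. by move=> e; apply/e; exists x. Qed.

Lemma ses_comp0 A B C (f : {linear A -> B}) (g : {linear B -> C}) x :
  ses f g -> g (f x) = 0.
Proof. by case=> _ e _; apply: exact_comp0 e. Qed.

Lemma kernel_exists B C (g : {linear B -> C}) :
  exists (K : lmodType R) (i : {linear K -> B}), injective i /\ exact_at 0 i g.
Proof.
apply: (@submodule_embedding R B [set y | g y = 0]); split=> [|a x y /= hx hy].
  exact: linear0.
by rewrite linearP hx hy scaler0 addr0.
Qed.

Lemma image_exists A B (f : {linear A -> B}) :
  exists (I : lmodType R) (p : {linear A -> I}) (j : {linear I -> B}),
    [/\ surj p, injective j & forall x, f x = j (p x)].
Proof.
have [|I [j [inj hj]]] := @submodule_embedding R B [set y | exists x, f x = y].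
  split=> [|a _ _ [x <-] [x' <-]]; first by exists 0; rewrite linear0.
  by exists (a *: x + x'); rewrite linearP.
have [|p hp] := factor_injective (g := f) inj.
  by move=> a; apply/hj; exists a.
exists I, p, j; split=> // y.
by have /hj[x hx] : exists k, j k = j y by [exists y]; exists x; apply: inj; rewrite hp.
Qed.

Lemma cokernel_exists A B (f : {linear A -> B}) :
  exists (Q : lmodType R) (p : {linear B -> Q}), surj p /\ exact_at 0 f p.
Proof.
apply: (@quotient_map R B [set y | exists x, f x = y]).
split=> [|a _ _ [x <-] [x' <-]]; first by exists 0; rewrite linear0.
by exists (a *: x + x'); rewrite linearP.
Qed.

Lemma pullback_exists A B C (f : {linear A -> C}) (g : {linear B -> C}) :
  exists (X : lmodType R) (p : {linear X -> A}) (q : {linear X -> B}),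
  [/\ forall x, f (p x) = g (q x),
      forall x, p x = 0 -> q x = 0 -> x = 0 &
      forall a b, f a = g b -> exists x, p x = a /\ q x = b].
Proof.
have [|X [i [inj hi]]] :=
    @submodule_embedding R (A * B)%type [set z | f z.1 = g z.2].
  split=> [|a x y /= hx hy]; first by rewrite /= !linear0.
  by rewrite !linearP hx hy.
exists X, (fst \o i : {linear X -> A}), (snd \o i : {linear X -> B}).
split=> /= [x|x|a b /(hi (a, b))[x ex]]; first by apply/hi; exists x.
- move=> h1 h2; apply: inj; rewrite linear0; case: (i x) h1 h2 => u v /= -> ->//.
- by exists x; rewrite ex.
Qed.

(** Base change of an extension along [h]: [k] sends a to the point over (f a, 0). The pullback
    enters through its properties, so that either projection can play the part of [q]. *)
Lemma pullback_ses A B C K (f : {linear K -> A}) (g : {linear A -> C})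
    (h : {linear B -> C}) X (p : {linear X -> A}) (q : {linear X -> B}) :
  (forall x, g (p x) = h (q x)) -> (forall x, p x = 0 -> q x = 0 -> x = 0) ->
  (forall a b, g a = h b -> exists x, p x = a /\ q x = b) ->
  ses f g -> exists k : {linear K -> X}, ses k q /\ forall x, p (k x) = f x.
Proof.
move=> com inj uni [fi fgE gs].
have [|||k hk] := @linear_of_relation R K X (fun a x => p x = f a /\ q x = 0).
- move=> a; apply: uni; rewrite linear0; apply/fgE; by exists a.
- by move=> x [h1 h2]; apply: inj; rewrite ?h1 ?linear0.
- move=> c a a' x x' [h1 h2] [h3 h4]; rewrite !linearP h1 h2 h3 h4.
  by rewrite scaler0 addr0.
exists k; split; last by move=> x; case: (hk x).
split.
- apply: linear_injective => x kx; apply: fi.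
  by case: (hk x) => <- _; rewrite kx !linear0.
- move=> x; split=> [qx|[a <-]]; last by case: (hk a).
  have /fgE[a ha] : g (p x) = 0 by rewrite com qx linear0.
  exists a; apply/eqP; rewrite -subr_eq0; apply/eqP.
  by have [h1 h2] := hk a; apply: inj; rewrite linearB ?h1 ?h2 ?ha ?qx subrr.
- by move=> b; have [a ga] := gs (h b); have [x [_ <-]] := uni _ _ ga; exists x.
Qed.

Lemma ses_pullback A A' B B' C (f : {linear A -> B}) (g : {linear B -> C})
    (f' : {linear A' -> B'}) (g' : {linear B' -> C}) :
  ses f g -> ses f' g' ->
  exists (X : lmodType R) (k : {linear A -> X}) (q : {linear X -> B'})
     (k' : {linear A' -> X}) (p : {linear X -> B}), ses k q /\ ses k' p.
Proof.
move=> h h'; have [X [p [q [com inj uni]]]] := pullback_exists g g'.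
have [k [hk _]] := pullback_ses com inj uni h.
have [|||k' [hk' _]] := @pullback_ses B' B C A' f' g' g X q p _ _ _ h'.
- by move=> x; rewrite com.
- by move=> x h1 h2; apply: inj.
- by move=> a b /esym/uni[x [h1 h2]]; exists x.
by exists X, k, q, k', p.
Qed.

(* L is the preimage of A in Q. *)
Lemma ses_kernel_comp A B C K Q (k : {linear K -> Q}) (p : {linear Q -> B})
    (f : {linear A -> B}) (g : {linear B -> C}) :
  ses k p -> ses f g ->
  exists (L : lmodType R) (i : {linear L -> Q}) (pc : {linear Q -> C})
     (j : {linear K -> L}) (q : {linear L -> A}),
  [/\ ses i pc, ses j q, forall x, i (j x) = k x & forall x, p (i x) = f (q x)].
Proof.
move=> [ki kp ps] [fi fg gs].
have [L [i [ii ie]]] := kernel_exists (g \o p : {linear Q -> C}).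
have [|q hq] := factor_injective (g := (p \o i : {linear L -> B})) fi.
  by move=> a; apply/fg; apply/(ie (i a)); exists a.
have [|j hj] := factor_injective (g := k) ii.
  by move=> a; apply/ie => /=; rewrite (kp (k a)).2 ?linear0//; exists a.
exists L, i, (g \o p : {linear Q -> C}), j, q; split=> //.
- split=> // c; have [b <-] := gs c; have [x <-] := ps b; by exists x.
- split.
  + by apply: linear_injective => x jx; apply: ki; rewrite -hj jx !linear0.
  + move=> x; split=> [qx|[a <-]].
      have /kp[a ka] : p (i x) = 0 by have := hq x => /= <-; rewrite qx linear0.
      by exists a; apply: ii; rewrite hj.
    by apply: fi; rewrite hq /= hj linear0; apply/kp; exists a.
  + move=> a; have [x hx] := ps (f a).
    have /ie[l hl] : (g \o p) x = 0 by rewrite /= hx; apply/fg; exists a.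
    by exists l; apply: fi; rewrite hq /= hl.
Qed.

(** X is the quotient of A' + B by the pairs (- h x, f x). The last two clauses, generators and
    relations, serve to define maps out of X. *)
Lemma pushout_ses A B C A' (f : {linear A -> B}) (g : {linear B -> C})
    (h : {linear A -> A'}) : ses f g ->
  exists (X : lmodType R) (i : {linear A' -> X}) (q : {linear X -> C})
    (j : {linear B -> X}),
  [/\ ses i q, forall x, j (f x) = i (h x),
      forall x, exists a b, x = i a + j b &
      forall a b, i a + j b = 0 -> exists x, a = - h x /\ b = f x].
Proof.
move=> [fi fg gs].
have [|X [p [ps pe]]] := @quotient_map R (A' * B)%type
    [set z | exists x, z = (- h x, f x)].
  split=> [|a _ _ [x ->] [x' ->]]; first by exists 0; rewrite !linear0 ?oppr0.
  by exists (a *: x + x'); rewrite [h (_ + _)]linearP [f (_ + _)]linearP opprD -scalerN.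
have [|i hi] := @linear_bundle R A' X (fun a => p (a, 0)).
  move=> a x y; rewrite -linearP; congr (p _).
  by change ((a *: x + y, 0) = (a *: x + y, a *: 0 + 0) :> A' * B); rewrite scaler0 addr0.
have [|j hj] := @linear_bundle R B X (fun b => p (0, b)).
  move=> a x y; rewrite -linearP; congr (p _).
  by change ((0, a *: x + y) = (a *: 0 + 0, a *: x + y) :> A' * B); rewrite scaler0 addr0.
have hij a b : i a + j b = p (a, b).
  rewrite hi hj -linearD; congr (p _).
  by change ((a + 0, 0 + b) = (a, b)); rewrite addr0 add0r.
have [|q hq] := factor_surjective (g := (g \o snd : {linear (A' * B)%type -> C})) ps.
  by move=> x /pe[y ->] /=; apply/fg; exists y.
exists X, i, q, j; split.
- split.
  + apply: linear_injective => a; rewrite hi => /pe[x [-> /esym fx]].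
    by rewrite (fi x 0) ?linear0 ?oppr0.
  + move=> x; have [[a b] <-] := ps x; rewrite hq /=; split.
      move=> /fg[y <-]; exists (a + h y); apply/eqP; rewrite -subr_eq0 hi -linearB.
      apply/eqP/pe; exists (- y).
      by rewrite !linearN opprK; congr pair => /=; rewrite ?sub0r// addrC addKr.
    move=> [y]; rewrite hi => /eqP; rewrite -subr_eq0 -linearB => /eqP/pe[z [_]].
    rewrite /= sub0r => /(congr1 -%R); rewrite opprK => ->.
    by apply/fg; exists (- z); rewrite linearN.
  + by move=> c; have [b <-] := gs c; exists (p (0, b)); rewrite hq.
- move=> x; rewrite hi hj; apply/eqP; rewrite -subr_eq0 -linearB.
  apply/eqP/pe; exists x; congr pair; rewrite /= ?sub0r ?subr0//.
- by move=> x; have [[a b] <-] := ps x; exists a, b; rewrite hij.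
- by move=> a b; rewrite hij => /pe[x [-> ->]]; exists x.
Qed.

End ExactSequences.

(** * Vanishing of Ext and projective resolutions *)

Section Ext.
Variable R : pzRingType.
Implicit Types A B C K L M N P Q X : lmodType R.

(** The extension property is required for all extensions of A, not only projective presentations;
    applied to an identity map it splits any extension of A by N. *)
Definition ext1_vanish A N : Prop :=
  forall K L (f : {linear K -> L}) (g : {linear L -> A}), ses f g ->
  forall h : {linear K -> N}, exists h' : {linear L -> N}, forall x, h' (f x) = h x.

(* Ext^(i+1)(M, N) = 0 (note the shift of the index), expressed without
   resolutions through dimension shifting. *)
Fixpoint ext_vanish (i : nat) M N : Prop :=
  match i with
  | 0 => ext1_vanish M N
  | j.+1 => forall K Q (f : {linear K -> Q}) (g : {linear Q -> M}),
      ses f g -> projective Q -> ext_vanish j K N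
  end.

(** A map on K is extended in two stages, first to the preimage L' of A, then to L, as L'/K is A and
    L/L' is C. *)
Lemma ext1_extension A B C N (f : {linear A -> B}) (g : {linear B -> C}) :
  ses f g -> ext1_vanish A N -> ext1_vanish C N -> ext1_vanish B N.
Proof.
move=> fg vA vC K L k p kp h.
have [L' [i [pc [j [q [ipc jq e _]]]]]] := ses_kernel_comp kp fg.
have [h1 eh1] := vA _ _ _ _ jq h; have [h2 eh2] := vC _ _ _ _ ipc h1.
by exists h2 => x; rewrite -e eh2 eh1.
Qed.

(** The extension of A is pulled back along [r] to one of X, where the map extends; [i] lifts to a
    map from L into the pullback. *)
Lemma ext1_retract A X N (i : {linear A -> X}) (r : {linear X -> A}) :
  (forall a, r (i a) = a) -> ext1_vanish X N -> ext1_vanish A N.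
Proof.
move=> ri vX K L f g [fi fgE gs] h.
have [Y [p [q [com inj uni]]]] := pullback_exists g r.
have [k [kq pk]] := pullback_ses com inj uni (And3 fi fgE gs).
have [h' eh'] := vX _ _ _ _ kq h.
have [|||s hs] := @linear_of_relation R L Y (fun l y => p y = l /\ q y = i (g l)).
- by move=> l; apply: uni; rewrite ri.
- by move=> y [h1 h2]; apply: inj => //; rewrite h2 !linear0.
- move=> a l l' y y' [h1 h2] [h3 h4]; rewrite !linearP h1 h2 h3 h4 //.
exists (h' \o s : {linear L -> N}) => x /=; rewrite -eh'; congr (h' _).
have [h1 h2] := hs (f x); apply/eqP; rewrite -subr_eq0; apply/eqP.
apply: inj; rewrite linearB ?h1 ?h2 ?pk ?subrr//.
by rewrite (exact_comp0 _ fgE) (ses_comp0 _ kq) !linear0 addr0.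
Qed.

Lemma ses_retraction A B C (f : {linear A -> B}) (g : {linear B -> C}) :
  ses f g -> ext1_vanish C A -> exists r : {linear B -> A}, forall a, r (f a) = a.
Proof. by move=> fg vC; have [r hr] := vC _ _ _ _ fg (idfun : {linear A -> A}); exists r. Qed.

Lemma ses_section A B C (f : {linear A -> B}) (g : {linear B -> C})
    (r : {linear B -> A}) : ses f g -> (forall a, r (f a) = a) ->
  exists s : {linear C -> B}, forall c, g (s c) = c.
Proof.
move=> [fi fg gs] hr.
have [|s hs] := factor_surjective (g := (idfun \- (f \o r) : {linear B -> B})) gs.
  by move=> x /fg[a <-] /=; rewrite hr subrr.
by exists s => c; have [b <-] := gs c; rewrite hs /= linearB (exact_comp0 _ fg) subr0.
Qed.

Lemma projective_section A P (g : {linear A -> P}) :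
  projective P -> surj g -> exists s : {linear P -> A}, forall x, g (s x) = x.
Proof. by move=> hP /(hP A P g (idfun : {linear P -> P})). Qed.

Lemma projective_ext1 Q N : projective Q -> ext1_vanish Q N.
Proof.
move=> hQ K L f g [fi fg gs] h.
have [s hs] := projective_section hQ gs.
have [|k hk] := factor_injective (g := (idfun \- (s \o g) : {linear L -> L})) fi.
  by move=> l; apply/fg; rewrite /= linearB hs subrr.
exists (h \o k : {linear L -> N}) => x /=; congr (h _); apply: fi.
by rewrite hk /= (exact_comp0 _ fg) linear0 subr0.
Qed.

Lemma projective_retract A X (i : {linear A -> X}) (r : {linear X -> A}) :
  (forall a, r (i a) = a) -> projective X -> projective A.
Proof.
move=> ri hX B C g f sg.
have [h hh] := hX B C g (f \o r : {linear X -> C}) sg.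
by exists (h \o i : {linear A -> B}) => x; rewrite /= hh /= ri.
Qed.

(** The kernel of a surjection between projectives is a direct summand, so the recursion stays among
    projectives. *)
Lemma ext_vanish_projective i Q N : projective Q -> ext_vanish i Q N.
Proof.
elim: i Q => [|i IH] Q hQ; first exact: projective_ext1.
move=> K Q' f g fg hQ'; apply: IH.
have [r hr] := ses_retraction fg (projective_ext1 (N := K) hQ).
exact: projective_retract hr hQ'.
Qed.

Lemma projective_pair P Q : projective P -> projective Q -> projective (P * Q)%type.
Proof.
move=> hP hQ A B g f sg.
have [|f1 hf1] := @linear_bundle R P B (fun a => f (a, 0)).
  move=> a x y; rewrite -linearP; congr (f _).
  by change ((a *: x + y, 0) = (a *: x + y, a *: 0 + 0) :> P * Q); rewrite scaler0 addr0.
have [|f2 hf2] := @linear_bundle R Q B (fun b => f (0, b)).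
  move=> a x y; rewrite -linearP; congr (f _).
  by change ((0, a *: x + y) = (a *: 0 + 0, a *: x + y) :> P * Q); rewrite scaler0 addr0.
have [h1 e1] := hP _ _ _ f1 sg; have [h2 e2] := hQ _ _ _ f2 sg.
exists ((h1 \o fst) \+ (h2 \o snd) : {linear (P * Q)%type -> A}) => -[a b] /=.
rewrite linearD e1 e2 hf1 hf2 -linearD; congr (f _).
by change ((a + 0, 0 + b) = (a, b)); rewrite addr0 add0r.
Qed.

(** This guards against vacuous truth: in positive degree [ext_vanish] quantifies over projective
    presentations, and says nothing until one is exhibited. *)
Definition resolvable M : Prop := inhabited (proj_resolution M).

(** Degree i + 2 of P' is degree i + 1 of P by conversion, so the transfer of cocycles, all that
    dimension shifting asks for, is immediate. *)
Lemma proj_resolution_splice M K Q (f : {linear K -> Q}) (g : {linear Q -> M})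
    (P : proj_resolution K) : ses f g -> projective Q ->
  exists P' : proj_resolution M, forall (N : lmodType R) i,
    (forall h : {linear res_obj P' i.+2 -> N}, cocycle h -> coboundary h) ->
    forall h : {linear res_obj P i.+1 -> N}, cocycle h -> coboundary h.
Proof.
move=> [fi fg gs] hQ.
pose obj i := match i with 0 => Q | j.+1 => res_obj P j end.
pose df i : {linear obj i.+1 -> obj i} :=
  match i return {linear obj i.+1 -> obj i} with
  | 0 => (f \o res_aug P : {linear res_obj P 0%N -> Q}) | j.+1 => res_diff P j end.
have pobj i : projective (obj i) by case: i => [|i] //; exact: res_proj.
have ex0 : exact_at 0 (df 0%N) g.
  move=> y; rewrite fg; split=> -[x <-].
    by have [z <-] := res_surj P x; exists z.
  by exists (res_aug P x).
have exS i : exact_at 0 (df i.+1) (df i).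
  case: i => [|i]; last exact: (res_exactS (p := P)).
  move=> y; rewrite -(res_exact0 (p := P) y) /=; split=> [e|->]; last by rewrite linear0.
  by apply: fi; rewrite e linear0.
by exists (ProjResolution pobj gs ex0 exS).
Qed.

Lemma proj_resolution_shift M K (P : proj_resolution M) (f : {linear K -> res_obj P 0%N}) :
  ses f (res_aug P) ->
  exists P' : proj_resolution K, forall (N : lmodType R) i,
    (forall h : {linear res_obj P' i.+1 -> N}, cocycle h -> coboundary h) ->
    forall h : {linear res_obj P i.+2 -> N}, cocycle h -> coboundary h.
Proof.
move=> [fi fg gs].
have [|e he] := factor_injective (g := res_diff P 0) fi.
  by move=> a; apply/fg; apply/(res_exact0 (p := P)); exists a.
have se : surj e.
  move=> x; have /(res_exact0 (p := P))[y hy] : res_aug P (f x) = 0 by apply/fg; exists x.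
  by exists y; apply: fi; rewrite he.
have ex0 : exact_at 0 (res_diff P 1) e.
  move=> y; rewrite -(res_exactS (p := P) (i := 0) y) -he; split=> [->|h]; first exact: linear0.
  by apply: fi; rewrite linear0.
by exists (ProjResolution (fun i => res_proj (p := P) (i := i.+1)) se ex0
  (fun i => res_exactS (p := P) (i := i.+1))).
Qed.

Lemma resolvable_cover M : resolvable M ->
  exists K Q (f : {linear K -> Q}) (g : {linear Q -> M}),
    [/\ ses f g, projective Q & resolvable K].
Proof.
move=> [P]; have [K [f [fi fe]]] := kernel_exists (res_aug P).
have fg : ses f (res_aug P) by split=> //; exact: res_surj.
have [P' _] := proj_resolution_shift fg.
by exists K, (res_obj P 0), f, (res_aug P); split=> //; exact: (res_proj (p := P)).
Qed.

End Ext.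

(** * Fragments of the long exact sequence *)

Section Ext.
Variable R : pzRingType.
Implicit Types A B C K L M N P Q X : lmodType R.

Lemma projective_zero : projective ('rV[R]_0 : lmodType R).
Proof.
move=> A B g f sg; exists (\0 : {linear 'rV[R]_0 -> A}) => x.
by rewrite [x]thinmx0 !linear0.
Qed.

Lemma resolvable_projective Q : projective Q -> resolvable Q.
Proof.
move=> hQ.
pose Z : lmodType R := 'rV[R]_0.
pose obj i : lmodType R := if i is 0 then Q else Z.
pose df i : {linear obj i.+1 -> obj i} := \0.
have z0 (x : Z) : x = 0 by exact: thinmx0.
have pobj i : projective (obj i) by case: i => [|i] //; exact: projective_zero.
have s0 : surj (idfun : {linear Q -> Q}) by move=> x; exists x.
have ex0 : exact_at 0 (df 0%N) (idfun : {linear Q -> Q}).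
  by move=> y /=; split=> [->|[x <-]//]; exists 0.
have exS i : exact_at 0 (df i.+1) (df i).
  by move=> y; split=> [_|_]; [exists 0; rewrite (z0 y)|].
exact: (inhabits (ProjResolution pobj s0 ex0 exS)).
Qed.

(** The middle cover is QA + QC, mapped by f p on QA and on QC by a lift [u] of q through g. *)
Lemma ses_horseshoe A B C (f : {linear A -> B}) (g : {linear B -> C})
    (KA QA : lmodType R) (a : {linear KA -> QA}) (p : {linear QA -> A})
    (KC QC : lmodType R) (c : {linear KC -> QC}) (q : {linear QC -> C}) :
  ses f g -> ses a p -> projective QA -> ses c q -> projective QC ->
  exists (KB QB : lmodType R) (b : {linear KB -> QB}) (r : {linear QB -> B})
    (f' : {linear KA -> KB}) (g' : {linear KB -> KC}),
  [/\ ses b r, projective QB & ses f' g'].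
Proof.
move=> [fi fg gs] [ai ap ps] hA [ci cq qs] hC.
have [u hu] := hC _ _ g q gs.
have [r rE] : exists r : {linear (QA * QC)%type -> B},
  forall x y, r (x, y) = f (p x) + u y.
- by exists ((f \o p \o fst) \+ (u \o snd) : {linear (QA * QC)%type -> B}).
have [KB [b [bi be]]] := kernel_exists r.
have gr z : g (r z) = q z.2.
  by case: z => x y; rewrite rE linearD hu (exact_comp0 _ fg) add0r.
have [|g' hg'] := factor_injective (g := (snd \o b : {linear KB -> QC})) ci.
  by move=> k; apply/cq; rewrite /= -gr (exact_comp0 _ be) linear0.
have [|i1 hi1] := @linear_bundle R QA (QA * QC)%type (fun x => (x, 0)).
  move=> k x y.
  by change ((k *: x + y, 0) = (k *: x + y, k *: 0 + 0) :> QA * QC); rewrite scaler0 addr0.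
have [|f' hf'] := factor_injective (g := (i1 \o a : {linear KA -> (QA * QC)%type})) bi.
  move=> k; apply/be; rewrite /= hi1 rE (exact_comp0 _ ap) !linear0.
  by rewrite addr0.
exists KB, (QA * QC)%type, b, r, f', g'; split; first split=> //.
- move=> y; have [z hz] := qs (g y).
  have /fg[x hx] : g (y - u z) = 0 by rewrite linearB hu hz subrr.
  have [w hw] := ps x; exists (w, z).
  by rewrite rE hw hx subrK.
- exact: projective_pair.
split.
- apply: linear_injective => x fx; apply: ai.
  by have /(congr1 fst) := hf' x; rewrite fx linear0 /= hi1 => /= <-; rewrite linear0.
- move=> x; split=> [gx|[y <-]].
    have b2 : (b x).2 = 0 by have := hg' x; rewrite gx linear0.
    have /ap[y hy] : p (b x).1 = 0.
      apply: fi; rewrite linear0; have := exact_comp0 x be.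
      by case: (b x) b2 => s t /= ->; rewrite rE linear0 addr0.
    exists y; apply: bi; rewrite hf' /= hi1 hy.
    by case: (b x) b2 => s t /= ->.
  by apply: ci; rewrite hg' /= hf' /= hi1 linear0.
- move=> k; have /fg[x hx] : g (u (c k)) = 0 by rewrite hu (exact_comp0 _ cq).
  have [w hw] := ps x.
  have /be[y hy] : r (- w, c k) = 0 by rewrite rE !linearN hw hx addNr.
  by exists y; apply: ci; rewrite hg' /= hy.
Qed.

(** This is Ext^(i+1)(B) -> Ext^(i+1)(A) -> Ext^(i+2)(C). For i = 0, the pullback X of B and a
    projective Q over C is an extension of B by the syzygy K of C, so Ext^1(X, N) = 0; it is also an
    extension of Q by A, which splits, so A is a summand of X. The horseshoe gives the induction
    step. *)
Lemma ext_vanish_sub i A B C N (f : {linear A -> B}) (g : {linear B -> C}) :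
  ses f g -> resolvable C ->
  ext_vanish i B N -> ext_vanish i.+1 C N -> ext_vanish i A N.
Proof.
elim: i A B C f g => [|i IH] A B C f g fg rC vB vC.
  have [K [Q [c [q [cq hQ _]]]]] := resolvable_cover rC.
  have [X [k [s [k' [p [kX k'X]]]]]] := ses_pullback fg cq.
  have vX := ext1_extension k'X (vC _ _ _ _ cq hQ) vB.
  have [r hr] := ses_retraction kX (projective_ext1 (N := A) hQ).
  exact: ext1_retract hr vX.
move=> KA QA a p ap hQA.
have [K [Q [c [q [cq hQ rK]]]]] := resolvable_cover rC.
have [KB [QB [b [r [f' [g' [br hQB fg']]]]]]] := ses_horseshoe fg ap hQA cq hQ.
by apply: IH fg' rK _ _; [exact: vB br hQB | exact: vC cq hQ].
Qed.

(** In a presentation of B, the preimage L of A is a syzygy of C and an extension of A by K, so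
    [ext_vanish_sub] applies to K inside L. *)
Lemma ext_vanish_extension i A B C N (f : {linear A -> B}) (g : {linear B -> C}) :
  ses f g -> resolvable A ->
  ext_vanish i A N -> ext_vanish i C N -> ext_vanish i B N.
Proof.
case: i => [|i] fg rA; first exact: ext1_extension fg.
move=> vA vC K Q k p kp hQ.
have [L [j [pc [j' [q [jpc jq _ _]]]]]] := ses_kernel_comp kp fg.
exact: ext_vanish_sub jq rA (vC _ _ _ _ jpc hQ) vA.
Qed.

(** The pullback X of B and Q over C is an extension of Q by A, whence its vanishing, and of B by K,
    to which [ext_vanish_sub] applies. *)
Lemma ext_vanish_quotient i A B C N (f : {linear A -> B}) (g : {linear B -> C}) :
  ses f g -> resolvable A -> resolvable B ->
  ext_vanish i A N -> ext_vanish i.+1 B N -> ext_vanish i.+1 C N.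
Proof.
move=> fg rA rB vA vB K Q c q cq hQ.
have [X [k [s [k' [p [kX k'X]]]]]] := ses_pullback fg cq.
have vX := ext_vanish_extension kX rA vA (ext_vanish_projective i N hQ).
exact: ext_vanish_sub k'X rB vX vB.
Qed.

Lemma ext_vanish_shift i K Q M N (f : {linear K -> Q}) (g : {linear Q -> M}) :
  ses f g -> projective Q -> resolvable K ->
  ext_vanish i K N -> ext_vanish i.+1 M N.
Proof.
move=> fg hQ rK vK; apply: ext_vanish_quotient fg rK _ vK _.
  exact: resolvable_projective.
exact: ext_vanish_projective.
Qed.

(** One projective presentation is enough: L is generated by Q (through a lift [u] of g) and K',
    glued along u f = k v, so a map on L is a pair of maps on Q and K' that agree there. *)
Lemma ext1_vanish_presentation K Q M N (f : {linear K -> Q}) (g : {linear Q -> M}) :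
  ses f g -> projective Q ->
  (forall h : {linear K -> N}, exists h' : {linear Q -> N}, forall x, h' (f x) = h x) ->
  ext1_vanish M N.
Proof.
move=> [fi fg gs] hQ hext K' L k p [ki kp ps] h.
have [u hu] := hQ _ _ p g ps.
have [|v hv] := factor_injective (g := (u \o f : {linear K -> L})) ki.
  by move=> x; apply/kp; rewrite /= hu (exact_comp0 _ fg).
have [h' eh'] := hext (h \o v : {linear K -> N}).
have [|||s hs] := @linear_of_relation R L N
    (fun l n => exists x y, l = u x + k y /\ n = h' x + h y).
- move=> l; have [x hx] := gs (p l).
  have /kp[y hy] : p (l - u x) = 0 by rewrite linearB hu hx subrr.
  by exists (h' x + h y), x, y; rewrite hy addrC subrK.
- move=> n [x [y [/esym e ->]]].
  have /fg[z hz] : g x = 0.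
    by move: (congr1 p e); rewrite linearD hu (exact_comp0 _ kp) linear0 addr0.
  have /ki -> : k y = k (- v z).
    by rewrite linearN hv /= hz; apply/eqP; rewrite -addr_eq0 addrC e.
  by rewrite -hz eh' /= linearN subrr.
- move=> c l l' n n' [x [y [-> ->]]] [x' [y' [-> ->]]].
  exists (c *: x + x'), (c *: y + y').
  by rewrite !linearP !scalerDr; split; rewrite addrACA.
exists s => y; have [x [z [e ->]]] := hs (k y).
have /fg[w hw] : g x = 0.
  by move: (congr1 p e); rewrite linearD hu !(exact_comp0 _ kp) addr0.
rewrite -hw eh' /= -linearD; congr (h _); apply: ki.
by rewrite linearD hv /= hw e.
Qed.

(** In degree 1 a cocycle is a map on the first syzygy, and its extension to P_0 makes it a
    coboundary; in higher degrees the first term of the resolution is dropped. *)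
Lemma ext_vanish_cocycle i M N (P : proj_resolution M)
    (h : {linear res_obj P i.+1 -> N}) :
  ext_vanish i M N -> cocycle h -> coboundary h.
Proof.
elim: i M P h => [|i IH] M P h vM;
  have [K [f [fi fe]]] := kernel_exists (res_aug P);
  have fg : ses f (res_aug P) by split=> //; exact: res_surj.
  move=> ch.
  have [|e he] := factor_injective (g := res_diff P 0) fi.
    by move=> a; apply/fe; apply/(res_exact0 (p := P)); exists a.
  have se : surj e.
    move=> x; have /(res_exact0 (p := P))[y hy] : res_aug P (f x) = 0 by apply/fe; exists x.
    by exists y; apply: fi; rewrite he.
  have [|h1 eh1] := factor_surjective (g := h) se.
    move=> x ex; have /(res_exactS (p := P) (i := 0))[y <-] : res_diff P 0 x = 0.
      by rewrite -he ex linear0.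
    exact: ch.
  have [h2 eh2] := vM _ _ _ _ fg h1.
  by exists h2 => x; rewrite -he eh2 eh1.
have [P' hP'] := proj_resolution_shift fg; apply: hP' => h'.
by apply: IH; apply: vM fg _; exact: (res_proj (p := P)).
Qed.

(** The hypothesis ranges over all resolutions, as the negation of [Ext_neq0] does: any resolution
    of the syzygy can then be spliced into one of M. *)
Lemma cocycle_ext_vanish i M N : resolvable M ->
  (forall (P : proj_resolution M) (h : {linear res_obj P i.+1 -> N}),
     cocycle h -> coboundary h) -> ext_vanish i M N.
Proof.
elim: i M => [|i IH] M rM hM.
  have [P] := rM; have [K [f [fi fe]]] := kernel_exists (res_aug P).
  have fg : ses f (res_aug P) by split=> //; exact: res_surj.
  have [|e he] := factor_injective (g := res_diff P 0) fi.
    by move=> a; apply/fe; apply/(res_exact0 (p := P)); exists a.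
  apply: ext1_vanish_presentation fg (res_proj (p := P) (i := 0)) _ => h.
  have [|h' eh'] := hM P (h \o e : {linear res_obj P 1 -> N}).
    move=> x; rewrite /= -(linear0 h); congr (h _); apply: fi.
    rewrite he linear0; exact: exact_comp0 (res_exactS (p := P) (i := 0)).
  exists h' => x.
  have /(res_exact0 (p := P))[y hy] : res_aug P (f x) = 0 by apply: exact_comp0 fe.
  by rewrite -hy -eh' /=; congr (h _); apply: fi; rewrite he.
have [K [Q [f [g [fg hQ rK]]]]] := resolvable_cover rM.
apply: (ext_vanish_shift fg hQ rK); apply: IH => // P h.
have [P' hP'] := proj_resolution_splice P fg hQ; apply: hP' => h'; exact: hM.
Qed.

End Ext.

(** * Finitely generated modules over a noetherian ring *)

Section FinitelyGenerated.
Variable R : pzRingType.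
Implicit Types A B C K L M N P Q X : lmodType R.

Lemma linear_of_rV n M (v : 'I_n -> M) :
  exists g : {linear 'rV[R]_n -> M}, forall x, g x = \sum_(i < n) x 0 i *: v i.
Proof.
have [|g hg] := @linear_bundle R 'rV[R]_n M (fun x => \sum_(i < n) x 0 i *: v i).
  move=> a x y; rewrite scaler_sumr -big_split; apply: eq_bigr => i _.
  by rewrite !mxE scalerDl scalerA.
by exists g.
Qed.

Lemma linear_rV_sum n M (g : {linear 'rV[R]_n -> M}) x :
  g x = \sum_(i < n) x 0 i *: g (delta_mx 0 i).
Proof.
by rewrite {1}[x]row_sum_delta linear_sum; apply: eq_bigr => i _; rewrite linearZ.
Qed.

Lemma linear_rV_choice n A M (f : {linear A -> M}) (g : {linear 'rV[R]_n -> M}) :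
  (forall i, exists a, f a = g (delta_mx 0 i)) ->
  exists h : {linear 'rV[R]_n -> A}, forall x, f (h x) = g x.
Proof.
move=> /choice[v hv]; have [h hh] := linear_of_rV v.
exists h; move=> x; rewrite hh linear_sum [RHS]linear_rV_sum.
by apply: eq_bigr => i _; rewrite linearZ hv.
Qed.

Lemma projective_rV n : projective ('rV[R]_n : lmodType R).
Proof. by move=> A B g f sg; apply: linear_rV_choice => i; apply: sg. Qed.

Lemma fg_cover M :
  finitely_generated M <-> exists n (g : {linear 'rV[R]_n -> M}), surj g.
Proof.
split=> [[n [v hv]]|[n [g sg]]].
  have [g hg] := linear_of_rV v; exists n, g => x; have [c ->] := hv x.
  by exists (\row_i c i); rewrite hg; apply: eq_bigr => i _; rewrite mxE.
exists n, (fun i => g (delta_mx 0 i)) => x; have [y <-] := sg x.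
by exists (y 0); rewrite linear_rV_sum.
Qed.

Lemma fg_rV n : finitely_generated ('rV[R]_n : lmodType R).
Proof. by apply/fg_cover; exists n, idfun => x; exists x. Qed.

Lemma fg_quotient M Q (p : {linear M -> Q}) :
  surj p -> finitely_generated M -> finitely_generated Q.
Proof.
move=> sp /fg_cover[n [g sg]]; apply/fg_cover; exists n, (p \o g) => q.
by have [x <-] := sp q; have [y <-] := sg x; exists y.
Qed.

Lemma fg_extension A B C (f : {linear A -> B}) (g : {linear B -> C}) :
  exact_at 0 f g -> surj g ->
  finitely_generated A -> finitely_generated C -> finitely_generated B.
Proof.
move=> fg gs /fg_cover[n [a sa]] /fg_cover[m [c sc]].
have [c' hc'] := @projective_rV m _ _ g c gs.
apply/fg_cover; exists (n + m)%N, ((f \o a \o lsubmx) \+ (c' \o rsubmx)) => b.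
have [y hy] := sc (g b).
have /fg[u hu] : g (b - c' y) = 0 by rewrite linearB hc' hy subrr.
have [x hx] := sa u; exists (row_mx x y).
by rewrite /= row_mxKl row_mxKr hx hu subrK.
Qed.

Hypothesis noethR : left_noetherian R.

(** Induction on n: the elements whose last n coordinates vanish form a left ideal, read off on the
    first coordinate; the image under the projection embeds into rows of length n. *)
Lemma noetherian_rV n A (i : {linear A -> 'rV[R]_n}) :
  injective i -> finitely_generated A.
Proof.
elim: n A i => [|n IH] A i inj.
  exists 0%N, (fun=> 0) => x; exists (fun=> 0); rewrite big_ord0.
  by apply: inj; rewrite [LHS]thinmx0 linear0 [RHS]thinmx0.
pose p : {linear 'rV[R]_(1 + n) -> 'rV[R]_n} := rsubmx.
have [K [k [ki ke]]] := kernel_exists (p \o i : {linear A -> 'rV[R]_n}).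
have [I [q [j [sq ij e]]]] := image_exists (p \o i : {linear A -> 'rV[R]_n}).
have kq : exact_at 0 k q.
  move=> y; rewrite -(ke y) e; split=> [->|h]; first exact: linear0.
  by apply: ij; rewrite h linear0.
apply: fg_extension kq sq _ _; last exact: IH ij.
pose c x := (i (k x) : 'rV[R]_(1 + n)) 0 0.
have cE x y : c x = c y -> x = y.
  move=> h; apply/ki/inj/rowP => t; move: h; rewrite /c.
  have /rowP hx := exact_comp0 x ke; have /rowP hy := exact_comp0 y ke.
  case: (unliftP 0 t) => [t' ->|-> //] _.
  have := hx t'; have := hy t'; rewrite /= !mxE -!rshift1 => -> <- //.
have cl a x y : c (a *: x + y) = a * c x + c y by rewrite /c !linearP !mxE.
have [|m [g hg]] := noethR (I := [set a | exists x, c x = a]).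
  split=> [|_ _ [x <-] [y <-]|a _ [x <-]].
  - by exists 0; rewrite /c !linear0 mxE.
  - by exists (1 *: x + y); rewrite cl mul1r.
  - by exists (a *: x + 0); rewrite cl /c !linear0 mxE addr0.
have /choice[v hv] : forall s, exists x, c x = g s.
  move=> s; apply/hg; exists (fun t => (t == s)%:R).
  rewrite (bigD1 s) //= eqxx mul1r big1 ?addr0 // => t /negPf ->; exact: mul0r.
exists m, v => x; have /hg[d hd] : exists y, c y = c x by exists x.
exists d; apply: cE; rewrite hd.
have [w hw] : exists w : {linear K -> R^o}, forall x, w x = c x.
  by apply: linear_bundle => a y z; rewrite cl.
by rewrite -hw linear_sum; apply: eq_bigr => s _; rewrite linearZ hw hv.
Qed.

Lemma noetherian_fg A M (i : {linear A -> M}) :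
  injective i -> finitely_generated M -> finitely_generated A.
Proof.
move=> inj /fg_cover[n [g sg]].
have [X [p [q [com injX uni]]]] := pullback_exists i g.
apply: (@fg_quotient X A p).
  by move=> a; have [y hy] := sg (i a); have [x [<- _]] := uni _ _ (esym hy); exists x.
apply: (@noetherian_rV n _ q); apply: linear_injective => x qx.
by apply: injX => //; apply: inj; rewrite com qx !linear0.
Qed.

Lemma fg_syzygy n M (g : {linear 'rV[R]_n -> M}) :
  exists m (D : 'M[R]_(m, n)), forall x, g x = 0 <-> exists y, y *m D = x.
Proof.
have [K [i [inj ie]]] := kernel_exists g.
have /fg_cover[m [p sp]] := noetherian_rV inj.
exists m, (lin1_mx (i \o p)) => x; rewrite (ie x); split=> [[k <-]|[y <-]].
  by have [y <-] := sp k; exists y; rewrite mul_rV_lin1.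
by exists (p y); rewrite mul_rV_lin1.
Qed.

(** The differentials are kept as matrices, since the dual complex will be obtained by transposing
    them. *)
Lemma free_resolution M : finitely_generated M ->
  exists (n : nat -> nat) (D : forall i, 'M[R]_(n i.+1, n i))
    (e : {linear 'rV[R]_(n 0%N) -> M}),
  [/\ surj e, forall x, e x = 0 <-> exists y, y *m D 0%N = x &
      forall i (x : 'rV[R]_(n i.+1)), x *m D i = 0 <-> exists y, y *m D i.+1 = x].
Proof.
move=> /fg_cover[n0 [e se]]; have [n1 [D0 hD0]] := fg_syzygy e.
(* A differential is packed with both ranks, so that the target rank of the next one is by
   conversion the source rank of the present one. *)
pose state := {n : nat & {m : nat & 'M[R]_(m, n)}}.
pose mat (s : state) : 'M[R]_(projT1 (projT2 s), projT1 s) := projT2 (projT2 s).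
have step (s : state) : exists t : {m : nat & 'M[R]_(m, projT1 (projT2 s))},
    forall x : 'rV_(projT1 (projT2 s)), x *m mat s = 0 <-> exists y, y *m projT2 t = x.
  have [m [D hD]] := fg_syzygy (mulmxr (mat s) : {linear 'rV[R]_(projT1 (projT2 s)) -> _}).
  by exists (existT _ m D) => x; exact: hD.
pose next (s : state) : state := existT _ (projT1 (projT2 s)) (projT1 (cid (step s))).
pose st i := iter i next (existT _ n0 (existT _ n1 D0)).
exists (fun i => projT1 (st i)), (fun i => mat (st i)), e.
split; [exact: se|exact: hD0|move=> i x].
exact: (projT2 (cid (step (st i)))).
Qed.

Lemma resolvable_fg M : finitely_generated M -> resolvable M.
Proof.
move=> /free_resolution[n [D [e [se h0 hS]]]].
pose d i : {linear 'rV[R]_(n i.+1) -> 'rV[R]_(n i)} := @mulmxr R 1 (n i.+1) (n i) (D i).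
have pobj i : projective ('rV[R]_(n i) : lmodType R) by exact: projective_rV.
have ex0 : exact_at 0 (d 0%N) e by exact: h0.
have exS i : exact_at 0 (d i.+1) (d i) by exact: hS.
exact: (inhabits (@ProjResolution R M (fun i => 'rV[R]_(n i)) d e pobj se ex0 exS)).
Qed.

End FinitelyGenerated.

(** * Bounds on pdstar and pd in terms of Ext *)

Lemma supremum_nat_le (A : set nat) (d : int) :
  (supremum -oo%E [set (i%:Z)%:E | i in A] <= d%:E)%E <->
  forall i, A i -> (i%:Z <= d).
Proof.
set B := image _ _.
have [A0|/set0P[i0 Ai0]] := eqVneq A set0.
  rewrite /B A0 image_set0 /supremum eqxx; split=> // _; exact: leNye.
have B0 : B != set0 by apply/set0P; exists (i0%:Z)%:E, i0.
(* [supremum] picks a least upper bound by choice, so one must be shown to exist: the maximum when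
   [A] is bounded, +oo otherwise. *)
have : supremums B (supremum -oo%E B).
  rewrite /supremum (negPf B0); apply: xgetPex.
  have [[m ub]|nub] := pselect (exists m, forall i, A i -> (i <= m)%N).
    have exA : exists i, `[< A i >] by exists i0; apply/asboolP.
    have bA i : `[< A i >] -> (i <= m)%N by move=> /asboolP /ub.
    have [M /asboolP AM maxM] := ex_maxnP exA bA.
    exists (M%:Z)%:E; split=> [_ [i Ai <-]|y]; last by apply; exists M.
    by rewrite lee_fin lez_nat; apply/maxM/asboolP.
  exists +oo%E; split=> [x _|y uy]; first exact: leey.
  case: y uy => [k|//|] uy.
    exfalso; apply: nub; exists `|k|%N => i Ai.
    have := uy (i%:Z)%:E; rewrite lee_fin => /(_ (ex_intro2 _ _ i Ai erefl)) h.
    by rewrite -lez_nat (le_trans h) // abszE ler_norm.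
  by have := uy (i0%:Z)%:E (ex_intro2 _ _ i0 Ai0 erefl).
move=> [ub lub]; split=> [h i Ai|h].
  by rewrite -lee_fin (le_trans _ h) //; apply: ub; exists i.
by apply: lub => _ [i Ai <-]; rewrite lee_fin h.
Qed.

Lemma infimum_nat_le (A : set nat) (d : nat) :
  (infimum +oo%E [set (i%:Z)%:E | i in A] <= (d%:Z)%:E)%E <->
  exists2 i, A i & (i <= d)%N.
Proof.
set B := image _ _.
have [A0|/set0P[i0 Ai0]] := eqVneq A set0.
  by rewrite /B A0 image_set0 /infimum eqxx; split=> [//|[]].
have B0 : B != set0 by apply/set0P; exists (i0%:Z)%:E, i0.
have exA : exists i, `[< A i >] by exists i0; apply/asboolP.
have [m /asboolP Am minm] := ex_minnP exA.
have lbm : lbound B (m%:Z)%:E.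
  by move=> _ [i Ai <-]; rewrite lee_fin lez_nat; apply/minm/asboolP.
have : infimums B (infimum +oo%E B).
  rewrite /infimum (negPf B0); apply: xgetPex; exists (m%:Z)%:E; split=> // y.
  by apply; exists m.
move=> [lb glb]; split=> [h|[i Ai hi]].
  by exists m => //; rewrite -lez_nat -lee_fin (le_trans _ h) //; exact: glb.
by rewrite (le_trans (lb _ (ex_intro2 _ _ i Ai erefl))) // lee_fin lez_nat.
Qed.

Section ProjectiveDimension.
Variable R : pzRingType.
Implicit Types A B C K L M N P Q X : lmodType R.

Lemma pdstar_ext_vanish M (d : int) i : resolvable M -> (pdstar M <= d%:E)%E ->
  d < i.+1%:Z -> ext_vanish i M R^o.
Proof.
move=> rM /supremum_nat_le h di; apply: cocycle_ext_vanish => // P f cf.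
have [//|nb] := pselect (coboundary f).
by have := h i.+1; rewrite leNgt di => /(_ (ex_intro _ P (ex_intro _ f (conj cf nb)))).
Qed.

Lemma ext_vanish_pdstar M (d : nat) :
  (forall i, (d <= i)%N -> ext_vanish i M R^o) -> (pdstar M <= (d%:Z)%:E)%E.
Proof.
move=> h; apply/supremum_nat_le => -[//|i] [P [f [cf nb]]].
rewrite lez_nat leqNgt; apply/negP => hi; apply: nb.
exact: ext_vanish_cocycle (h i _) cf.
Qed.

Lemma pd1_ext_vanish M N i : (pd M <= 1%:E)%E -> ext_vanish i.+1 M N.
Proof.
move=> /(infimum_nat_le _ 1)[l [P hP] hl].
have [K [f [fi fe]]] := kernel_exists (res_aug P).
have fg : ses f (res_aug P) by split=> //; exact: res_surj.
have [|e he] := factor_injective (g := res_diff P 0) fi.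
  by move=> a; apply/fe; apply/(res_exact0 (p := P)); exists a.
have se : surj e.
  move=> x; have /(res_exact0 (p := P))[y hy] : res_aug P (f x) = 0 by apply/fe; exists x.
  by exists y; apply: fi; rewrite he.
(* The resolution stops at an index l at most 1, so its object at index 2 is zero and P_1 maps
   isomorphically onto the syzygy K. *)
have ie x : e x = 0 -> x = 0.
  move=> ex; have /(res_exactS (p := P) (i := 0))[y <-] : res_diff P 0 x = 0.
    by rewrite -he ex linear0.
  by rewrite (hP 2%N _ y) ?linear0 // (leq_ltn_trans hl).
have [s hs] := factor_surjective (g := (idfun : {linear res_obj P 1 -> _})) se ie.
have hK : projective K.
  apply: (@projective_retract R K (res_obj P 1) s e _ (res_proj (p := P) (i := 1))) => x.
  by have [y <-] := se x; rewrite hs.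
apply: ext_vanish_shift fg (res_proj (p := P) (i := 0)) (resolvable_projective hK) _.
exact: ext_vanish_projective.
Qed.

(** Lifting f through g amounts to splitting the pullback of g along f, an extension of K by the
    kernel of g. *)
Lemma ext1_vanish_all_projective K : (forall N, ext1_vanish K N) -> projective K.
Proof.
move=> hK A B g f sg.
have [A' [i [ii ie]]] := kernel_exists g.
have [X [p [q [com inj uni]]]] := pullback_exists g f.
have [k [kq _]] := pullback_ses com inj uni (And3 ii ie sg).
have [r hr] := ses_retraction kq (hK _); have [s hs] := ses_section kq hr.
by exists (p \o s) => x; rewrite /= com hs.
Qed.

Lemma projective_kernel_pd1 K Q M (f : {linear K -> Q}) (g : {linear Q -> M}) :
  ses f g -> projective Q -> projective K -> (pd M <= 1%:E)%E.
Proof.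
move=> [fi fg gs] hQ hK; apply/(infimum_nat_le _ 1); exists 1%N => //.
pose Z : lmodType R := 'rV[R]_0.
have z0 (x : Z) : x = 0 by exact: thinmx0.
pose obj i : lmodType R := match i with 0 => Q | 1 => K | _ => Z end.
pose df i : {linear obj i.+1 -> obj i} :=
  match i return {linear obj i.+1 -> obj i} with 0 => f | _ => \0 end.
have pobj i : projective (obj i) by case: i => [|[|i]] //; exact: projective_zero.
have exS i : exact_at 0 (df i.+1) (df i).
  case: i => [|i] y; last first.
    by split=> [_|[x <-]]; [exists 0; rewrite (z0 y) linear0|].
  split=> /= [e|[x <-]]; last by rewrite linear0.
  by exists 0; apply: fi; rewrite e linear0.
by exists (@ProjResolution R M obj df g pobj gs fg exS) => -[|[|i]] //= _ x; exact: z0.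
Qed.

Lemma ext_vanish_pd1 M : finitely_generated M ->
  (forall N, ext_vanish 1 M N) -> (pd M <= 1%:E)%E.
Proof.
move=> /fg_cover[n [g sg]] hM.
have [K [f [fi fe]]] := kernel_exists g.
have fg : ses f g by [].
apply: (projective_kernel_pd1 fg (@projective_rV R n)).
apply: ext1_vanish_all_projective => N.
exact: hM _ _ _ _ _ fg (@projective_rV R n).
Qed.

End ProjectiveDimension.

(** * Ore sets, torsion modules, closure properties of C and P *)

Lemma ore_set_converse (R : pzRingType) (S : set R) :
  ore_set S -> ore_set (S : set R^c).
Proof.
move=> [reg S1 SM ore]; split=> //.
- by move=> f /reg[].
- by move=> f g Sf Sg; apply: SM.
- by move=> f a /(ore f a)[h1 h2].
Qed.

Section Torsion.
Variables (R : pzRingType) (S : set R).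
Hypothesis oreS : ore_set S.
Implicit Types A B C K L M N P Q X : lmodType R.

Lemma common_annihilator M (l : seq M) : torsion S M ->
  exists s, S s /\ forall x, x \in l -> s *: x = 0.
Proof.
have [_ S1 SM _] := oreS; move=> tM; elim: l => [|x l [s [Ss hs]]].
  by exists 1.
have [t [St ht]] := tM (s *: x); exists (t * s); split; first exact: SM.
move=> y; rewrite inE -scalerA => /orP[/eqP -> //|/hs ->]; exact: scaler0.
Qed.

(** Each new element enlarges the multiplier by a left factor, which preserves the divisibility by
    [f] on the right already obtained. *)
Lemma ore_common_denominator f (l : seq R) : S f ->
  exists t, S t /\ forall a, a \in l -> exists b, t * a = b * f.
Proof.
have [_ S1 SM ore] := oreS; move=> Sf; elim: l => [|x l [s [Ss hs]]].
  by exists 1.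
have [_ [b [t [St ht]]]] := ore f (s * x) Sf.
exists (t * s); split; first exact: SM.
move=> y; rewrite inE -mulrA => /orP[/eqP ->|/hs[c ->]]; first by exists b.
by exists (t * c); rewrite mulrA.
Qed.

Lemma ore_common_denominator_mx m n f (A : 'M[R]_(m, n)) : S f ->
  exists t (B : 'M[R]_(m, n)), S t /\ t *: A = B *m f%:M.
Proof.
move=> Sf.
have [t [St ht]] := ore_common_denominator [seq A u.1 u.2 | u : 'I_m * 'I_n] Sf.
have /choice[b hb] (u : 'I_m * 'I_n) : exists b, t * A u.1 u.2 = b * f.
  by apply: ht; apply/mapP; exists u => //; rewrite mem_enum.
exists t, (\matrix_(i, j) b (i, j)); split=> //; apply/matrixP => i j.
rewrite !mxE (hb (i, j)) (bigD1 j) //= big1 ?addr0 => [|k /negPf kj].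
  by rewrite !mxE eqxx mulr1n.
by rewrite !mxE kj mulr0n mulr0.
Qed.

Lemma torsion_sub A M (i : {linear A -> M}) : injective i -> torsion S M -> torsion S A.
Proof.
by move=> inj tM x; have [s [Ss h]] := tM (i x); exists s; split=> //; apply: inj;
   rewrite linearZ /= h linear0.
Qed.

Lemma torsion_quotient M Q (p : {linear M -> Q}) : surj p -> torsion S M -> torsion S Q.
Proof.
move=> sp tM q; have [x <-] := sp q; have [s [Ss h]] := tM x.
by exists s; split=> //; rewrite -linearZ h linear0.
Qed.

Lemma torsion_extension A B C (f : {linear A -> B}) (g : {linear B -> C}) :
  exact_at 0 f g -> torsion S A -> torsion S C -> torsion S B.
Proof.
have [_ _ SM _] := oreS; move=> fg tA tC x.
have [s [Ss hs]] := tC (g x).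
have /fg[a ha] : g (s *: x) = 0 by rewrite linearZ.
have [t [St ht]] := tA a; exists (t * s); split; first exact: SM.
by rewrite -scalerA -ha -linearZ ht linear0.
Qed.

Lemma in_M_extension A B C (f : {linear A -> B}) (g : {linear B -> C}) :
  ses f g -> in_M S A -> in_M S C -> in_M S B.
Proof.
move=> [_ fg sg] [fA tA] [fC tC]; split; first exact: fg_extension fg sg fA fC.
exact: torsion_extension fg tA tC.
Qed.

Lemma in_M_quotient M Q (p : {linear M -> Q}) : surj p -> in_M S M -> in_M S Q.
Proof. by move=> sp [fM tM]; split; [exact: fg_quotient sp fM|exact: torsion_quotient sp tM]. Qed.

Hypothesis noethR : left_noetherian R.

Lemma in_M_sub A M (i : {linear A -> M}) : injective i -> in_M S M -> in_M S A.
Proof.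
by move=> inj [fM tM]; split; [exact: noetherian_fg noethR _ _ _ inj fM|exact: torsion_sub inj tM].
Qed.

(** As [ext_vanish i.+1] is Ext^(i+2), the second condition is Ext^j(M, R) = 0 for all j at least
    2. *)
Lemma in_C_ext_vanish M : in_C S M <->
  in_M S M /\ forall i, ext_vanish i.+1 M R^o.
Proof.
split=> [[[fM tM] h]|[hM h]]; split=> //.
  by move=> i; apply: pdstar_ext_vanish (resolvable_fg noethR fM) h _.
by apply: (@ext_vanish_pdstar R M 1) => -[|i].
Qed.

Lemma in_P_ext_vanish M : in_P S M <->
  in_M S M /\ forall i N, ext_vanish i.+1 M N.
Proof.
split=> [[hM h]|[hM h]]; split=> //; first by move=> i N; exact: pd1_ext_vanish.
by apply: ext_vanish_pd1 => [|N]; [case: hM | exact: h].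
Qed.

Lemma in_P_in_C M : in_P S M -> in_C S M.
Proof. by move=> /in_P_ext_vanish[hM h]; apply/in_C_ext_vanish. Qed.

Lemma in_M_resolvable M : in_M S M -> resolvable M.
Proof. by case=> fM _; exact: resolvable_fg. Qed.

Lemma in_P_zero M : (forall x : M, x = 0) -> in_P S M.
Proof.
move=> h0; have [_ S1 _ _] := oreS.
apply/in_P_ext_vanish; split; first split.
- by exists 0%N, (fun=> 0) => x; exists (fun=> 0); rewrite big_ord0 (h0 x).
- by move=> x; exists 1; split=> //; rewrite (h0 (1 *: x)).
move=> i N; apply: ext_vanish_projective => A B g f _; exists \0 => x.
by rewrite (h0 x) !linear0.
Qed.

Lemma in_C_kernel A B C (f : {linear A -> B}) (g : {linear B -> C}) :
  ses f g -> in_C S B -> in_C S C -> in_C S A.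
Proof.
move=> fg /in_C_ext_vanish[hB vB] /in_C_ext_vanish[hC vC]; apply/in_C_ext_vanish.
have [fi _ _] := fg; split; first exact: in_M_sub fi hB.
by move=> i; apply: ext_vanish_sub fg (in_M_resolvable hC) (vB i) (vC i.+1).
Qed.

Lemma in_C_extension A B C (f : {linear A -> B}) (g : {linear B -> C}) :
  ses f g -> in_C S A -> in_C S C -> in_C S B.
Proof.
move=> fg /in_C_ext_vanish[hA vA] /in_C_ext_vanish[hC vC]; apply/in_C_ext_vanish.
split; first exact: in_M_extension fg hA hC.
by move=> i; apply: ext_vanish_extension fg (in_M_resolvable hA) (vA i) (vC i).
Qed.

Lemma in_P_kernel A B C (f : {linear A -> B}) (g : {linear B -> C}) :
  ses f g -> in_P S B -> in_P S C -> in_P S A.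
Proof.
move=> fg /in_P_ext_vanish[hB vB] /in_P_ext_vanish[hC vC]; apply/in_P_ext_vanish.
have [fi _ _] := fg; split; first exact: in_M_sub fi hB.
by move=> i N; apply: ext_vanish_sub fg (in_M_resolvable hC) (vB i N) (vC i.+1 N).
Qed.

Lemma ext1_vanish_rV n K : ext1_vanish K R^o -> ext1_vanish K 'rV[R]_n.
Proof.
move=> vK A B f g fg h.
have /choice[u hu] (j : 'I_n) : exists u : {linear B -> R^o}, forall x, u (f x) = h x 0 j.
  have [|w hw] := @linear_bundle R A R^o (fun x => h x 0 j).
    by move=> a x y; rewrite linearP !mxE.
  by have [u hu] := vK _ _ _ _ fg w; exists u => x; rewrite hu hw.
have [|h' hh'] := @linear_bundle R B 'rV[R]_n (fun x => \row_j u j x).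
  by move=> a x y; apply/rowP => j; rewrite !mxE linearP.
by exists h' => x; rewrite hh'; apply/rowP => j; rewrite mxE hu.
Qed.

(* C has projective dimension at most 2, so a second syzygy L of C is finitely
   generated projective; the vanishing of Ext^2(C, R) then splits the first
   syzygy off a free module. *)
Lemma in_P_cokernel A B C (f : {linear A -> B}) (g : {linear B -> C}) :
  ses f g -> in_P S A -> in_P S B -> in_C S C -> in_P S C.
Proof.
move=> fg /in_P_ext_vanish[hA vA] /in_P_ext_vanish[hB vB] /in_C_ext_vanish[hC vC].
have v2 N : ext_vanish 2 C N.
  by apply: ext_vanish_quotient fg (in_M_resolvable hA) (in_M_resolvable hB) (vA 0%N N) (vB 1%N N).
split=> //; have [/fg_cover[n [c sc]] _] := hC.
have [K [k [ki ke]]] := kernel_exists c.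
have kc : ses k c by [].
have /fg_cover[m [p sp]] := noetherian_rV noethR ki.
have [L [l [li le]]] := kernel_exists p.
have lp : ses l p by [].
have hL : projective L.
  apply: ext1_vanish_all_projective => N.
  exact: v2 _ _ _ _ _ kc (@projective_rV R n) _ _ _ _ lp (@projective_rV R m).
have /fg_cover[q [r sr]] := noetherian_rV noethR li.
have [s hs] := projective_section hL sr.
have [s' hs'] := ext1_vanish_rV (vC 0%N _ _ _ _ kc (@projective_rV R n)) lp s.
have [|t ht] := ses_section (r := (r \o s' : {linear 'rV[R]_m -> L})) lp.
  by move=> x; rewrite /= hs' hs.
have hK : projective K := projective_retract ht (@projective_rV R m).
exact: projective_kernel_pd1 kc (@projective_rV R n) hK.
Qed.

Lemma mulmx_scalar_reg m n f (A : 'M[R]_(m, n)) : S f -> A *m f%:M = 0 -> A = 0.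
Proof.
have [reg _ _ _] := oreS; move=> /reg[_ rf] /matrixP h; apply/matrixP => i j.
have := h i j; rewrite !mxE (bigD1 j) //= big1 ?addr0 => [|k /negPf kj].
  by rewrite !mxE eqxx mulr1n => e; apply: rf; rewrite e mul0r.
by rewrite !mxE kj mulr0n mulr0.
Qed.

Lemma scale_mx_reg m n f (A : 'M[R]_(m, n)) : S f -> f *: A = 0 -> A = 0.
Proof.
have [reg _ _ _] := oreS; move=> /reg[lf _] /matrixP h; apply/matrixP => i j.
by have := h i j; rewrite !mxE => e; apply: lf; rewrite e mulr0.
Qed.

(** P is (R/Rt)^n: right multiplication by t is left linear and injective, giving a free resolution
    of length 1, and the Ore condition makes the quotient torsion. *)
Lemma in_P_free_quotient n t : S t ->
  exists (P : lmodType R) (p : {linear 'rV[R]_n -> P}),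
  [/\ in_P S P, surj p & forall x, p x = 0 <-> exists y, y *m t%:M = x].
Proof.
move=> St; pose r : {linear 'rV[R]_n -> 'rV[R]_n} := mulmxr t%:M.
have [P [p [sp pe]]] := cokernel_exists r.
have rp : ses r p.
  by split=> //; apply: linear_injective => x; exact: mulmx_scalar_reg.
exists P, p; split=> //; split; last first.
  exact: projective_kernel_pd1 rp (@projective_rV R n) (@projective_rV R n).
split; first exact: fg_quotient sp (fg_rV R n).
move=> y; have [x <-] := sp y.
have [s [b [Ss e]]] := ore_common_denominator_mx x St.
by exists s; split=> //; rewrite -linearZ; apply/pe; exists b; rewrite e.
Qed.

Lemma in_C_cover M : in_C S M ->
  exists (N P : lmodType R) (f : {linear N -> P}) (g : {linear P -> M}),
  [/\ ses f g, in_P S P & in_C S N].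
Proof.
move=> hM; have [[/fg_cover[n [c sc]] tM] _] := hM.
have [s [Ss hs]] := common_annihilator [seq c (delta_mx 0 i) | i : 'I_n] tM.
have [P [p [hP sp pe]]] := in_P_free_quotient n Ss.
have [|g hg] := factor_surjective (g := c) sp.
  move=> x /pe[y <-].
  (* Without commutativity [c (y *m s%:M)] need not be [s *: c y]; the two agree on basis rows, and
     linearity of the former in y does the rest. *)
  have [|h hh] := @linear_bundle R 'rV[R]_n M (fun y => c (y *m s%:M)).
    by move=> a u v; rewrite mulmxDl -scalemxAl linearP.
  rewrite -hh linear_rV_sum big1 // => i _; rewrite hh.
  have -> : delta_mx 0 i *m s%:M = s *: delta_mx 0 i :> 'rV[R]_n.
    apply/rowP => j; rewrite !mxE (bigD1 i) //= big1 ?addr0 => [|k /negPf ki].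
      by rewrite !mxE !eqxx mul1r eq_sym mulr_natr.
    by rewrite !mxE ki andbF mul0r.
  by rewrite linearZ /= hs ?scaler0 //; apply/mapP; exists i => //; rewrite mem_enum.
have sg : surj g by move=> y; have [x <-] := sc y; exists (p x); rewrite hg.
have [N [f [fi fe]]] := kernel_exists g.
have fg : ses f g by [].
exists N, P, f, g; split=> //; exact: in_C_kernel fg (in_P_in_C hP) hM.
Qed.

End Torsion.

(** * Functionals on syzygies of free modules *)

Section Embedding.
Variable R : pzRingType.
Implicit Types A B C K L M N P Q X : lmodType R.

Lemma functional_column n (g : {linear 'rV[R]_n -> R^o}) :
  exists y : 'cV[R]_n, forall x, g x = (x *m y) 0 0.
Proof.
exists (\col_i g (delta_mx 0 i)) => x; rewrite linear_rV_sum mxE.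
by apply: eq_bigr => i _; rewrite mxE.
Qed.

Lemma column_functional n (y : 'cV[R]_n) :
  exists g : {linear 'rV[R]_n -> R^o}, forall x, g x = (x *m y) 0 0.
Proof. by apply: linear_bundle => a u v; rewrite mulmxDl -scalemxAl !mxE. Qed.

Lemma mulmx_rows_ext m n (A B : 'M[R]_(m, n)) :
  (forall x : 'rV[R]_m, x *m A = x *m B) -> A = B.
Proof. by move=> h; apply/row_matrixP => i; rewrite !rowE. Qed.

Lemma mulmx_columns_ext m n (A B : 'M[R]_(m, n)) :
  (forall c : 'cV[R]_n, A *m c = B *m c) -> A = B.
Proof.
move=> h; apply/matrixP => i j; have := h (delta_mx j 0).
by rewrite -!colE => /colP/(_ i); rewrite !mxE.
Qed.

Lemma mx11_eq (A B : 'M[R]_1) : A 0 0 = B 0 0 -> A = B.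
Proof. by move=> h; apply/matrixP => i j; rewrite !ord1. Qed.

(* K = ker E_0 maps with cokernel ker E_1 into a free module, and ker E_1 is a
   k-th syzygy of ker E_(k+1) for every k; by dimension shifting the bound d gives
   Ext^1(ker E_1, R) = 0. *)
Lemma syzygy_functional (d : int) (n : nat -> nat)
    (E : forall j, 'M[R]_(n j, n j.+1)) :
  left_noetherian R ->
  (forall M, finitely_generated M -> (pdstar M <= d%:E)%E) ->
  (forall j (x : 'rV[R]_(n j.+1)), x *m E j.+1 = 0 <-> exists y, y *m E j = x) ->
  forall K (i : {linear K -> 'rV[R]_(n 0%N)}) (f : {linear K -> R^o}),
  injective i -> (forall x, x *m E 0%N = 0 <-> exists k, i k = x) ->
  exists y : 'cV[R]_(n 0%N), forall k, f k = (i k *m y) 0 0.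
Proof.
move=> noethR bound ex K0 i0 f0 inj0 ker0.
pose e j : {linear 'rV[R]_(n j) -> 'rV[R]_(n j.+1)} := mulmxr (E j).
have ses_e j K L (i : {linear K -> 'rV[R]_(n j)}) (l : {linear L -> 'rV[R]_(n j.+1)}) :
    injective i -> exact_at 0 i (e j) -> injective l -> exact_at 0 l (e j.+1) ->
    exists p : {linear 'rV[R]_(n j) -> L}, ses i p.
  move=> ii ie li le.
  have [|p hp] := factor_injective (g := e j) li.
    by move=> a; apply/le/ex; exists a.
  exists p; split=> //.
    by move=> y; rewrite -ie -hp; split=> [->|h]; [exact: linear0|apply: li; rewrite h linear0].
  move=> x; have /ex[y hy] : e j.+1 (l x) = 0 by apply/le; exists x.
  by exists y; apply: li; rewrite hp.
have van k j K (i : {linear K -> 'rV[R]_(n j)}) :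
    injective i -> exact_at 0 i (e j) -> ext_vanish k K R^o.
  (* [m] bounds the number of shifts left before the Ext index exceeds |d|; when it reaches 0,
     [bound] gives the vanishing. *)
  have [m hm] : exists m, (`|d| <= k + m)%N by exists `|d|%N; exact: leq_addl.
  elim: m k j K i hm => [|m IH] k j K i hm ii ie.
    have fK := noetherian_rV noethR ii.
    apply: pdstar_ext_vanish (resolvable_fg noethR fK) (bound _ fK) _.
    rewrite addn0 in hm; apply: le_lt_trans (_ : `|d|%N%:Z < _).
      by rewrite abszE ler_norm.
    by rewrite ltz_nat ltnS.
  have [L [l [li le]]] := kernel_exists (e j.+1).
  have [p ip] := ses_e _ _ _ _ _ ii ie li le.
  have := IH k.+1 j.+1 L l; rewrite addSnnS => /(_ hm li le) /= vL.
  exact: vL _ _ _ _ ip (@projective_rV R _).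
have [L [l [li le]]] := kernel_exists (e 1%N).
have [p ip] := ses_e _ _ _ _ _ inj0 (fun x => ker0 x) li le.
have [g hg] := van 0%N _ _ _ li le _ _ _ _ ip f0.
have [y hy] := functional_column g.
by exists y => k; rewrite -hg hy.
Qed.

End Embedding.

(** * Transposition between R and R^c *)

Section ConverseMatrices.
Variable R : pzRingType.

(** Changing the ring to R^c makes transposition reverse products, and turns left multiplication on
    columns into right multiplication on rows, the form used for left modules. *)
Definition to_converse m n (A : 'M[R]_(m, n)) : 'M[R^c]_(n, m) := A^T.
Definition of_converse m n (A : 'M[R^c]_(m, n)) : 'M[R]_(n, m) := A^T.

Lemma to_converseK m n : cancel (@to_converse m n) (@of_converse n m).
Proof. exact: trmxK. Qed.

Lemma of_converseK m n : cancel (@of_converse m n) (@to_converse n m).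
Proof. exact: trmxK. Qed.

Lemma of_converse0 m n : of_converse (0 : 'M[R^c]_(m, n)) = 0.
Proof. exact: trmx0. Qed.

Lemma of_converseM m n p (A : 'M[R^c]_(m, n)) (B : 'M[R^c]_(n, p)) :
  of_converse (A *m B) = of_converse B *m of_converse A.
Proof. by apply/matrixP => i j; rewrite !mxE; apply: eq_bigr => k _; rewrite !mxE. Qed.

Lemma of_converse_eq0 m n (A : 'M[R^c]_(m, n)) : A = 0 <-> of_converse A = 0.
Proof.
split=> [->|h]; first exact: of_converse0.
by rewrite -[A]of_converseK h; exact: trmx0.
Qed.

Lemma of_converse_scalar n (a : R^c) : of_converse (a%:M : 'M[R^c]_n) = (a : R)%:M.
Proof. by apply/matrixP => i j; rewrite !mxE eq_sym. Qed.

End ConverseMatrices.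

(** * Embedding an object of C into an object of P *)

Section EmbeddingOfC.
Variables (R : pzRingType) (S : set R) (d : int).
Hypothesis noethR : left_noetherian R.
Hypothesis noethRc : left_noetherian R^c.
Hypothesis oreS : ore_set S.
Hypothesis bound : forall M : lmodType R^c, finitely_generated M -> (pdstar M <= d%:E)%E.
Implicit Types A B C K L M N P Q X : lmodType R.

Section FreeResolution.
Variables (M : lmodType R) (n : nat -> nat) (D : forall i, 'M[R]_(n i.+1, n i))
  (e : {linear 'rV[R]_(n 0%N) -> M}).
Hypothesis se : surj e.
Hypothesis e0 : forall x, e x = 0 <-> exists y, y *m D 0%N = x.
Hypothesis eS : forall i (x : 'rV[R]_(n i.+1)), x *m D i = 0 <-> exists y, y *m D i.+1 = x.

Lemma resolution_mul0 i : D i.+1 *m D i = 0.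
Proof. by apply: mulmx_rows_ext => x; rewrite mulmx0 mulmxA; apply/eS; exists x. Qed.

(** A functional on rows is a column, so the D_i acting on columns form the dual complex; the claim
    is its exactness in degree i + 1. *)
Lemma ext_vanish_columns i (y : 'cV[R]_(n i.+1)) : ext_vanish i M R^o ->
  D i.+1 *m y = 0 <-> exists z, D i *m z = y.
Proof.
move=> vM; split=> [Dy|[z <-]]; last by rewrite mulmxA resolution_mul0 mul0mx.
pose df j : {linear 'rV[R]_(n j.+1) -> 'rV[R]_(n j)} := mulmxr (D j).
have pobj j : projective ('rV[R]_(n j) : lmodType R) by exact: projective_rV.
have ex0 : exact_at 0 (df 0%N) e by exact: e0.
have exS j : exact_at 0 (df j.+1) (df j) by exact: eS.
pose P := @ProjResolution R M (fun j => 'rV[R]_(n j)) df e pobj se ex0 exS.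
have [h hh] := column_functional y.
have [|g hg] := @ext_vanish_cocycle R i M R^o P h vM.
  by move=> x; rewrite hh -mulmxA Dy mulmx0 mxE.
have [z hz] := functional_column g.
exists z; apply: mulmx_rows_ext => x; apply: mx11_eq.
by rewrite mulmxA -hz -hh hg.
Qed.

(* With Omega the image of D_0, the columns of Z generate Hom(Omega, R). The
   second clause says that Omega is reflexive: z |-> s^-1 (u z) is a functional on
   Hom(Omega, R), hence the evaluation at some x. *)
Lemma dual_syzygy_generators : (forall i, ext_vanish i.+1 M R^o) ->
  exists k (Z : 'M[R]_(n 1%N, k)),
    (forall y : 'cV[R]_(n 1%N), D 1%N *m y = 0 <-> exists c, Z *m c = y) /\
    (forall (u : 'rV[R]_(n 1%N)) s r, S s -> u *m Z = s *: r ->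
       exists x, (u - s *: x) *m Z = 0).
Proof.
move=> vM.
(* Over R^c the dual complex from D_1 on becomes a sequence of rows as in [syzygy_functional], and
   the kernel of [E 0] is Hom(Omega, R). *)
pose E j : 'M[R^c]_(n j.+1, n j.+2) := to_converse (D j.+1).
have rowE j (x : 'rV[R^c]_(n j.+1)) : x *m E j = 0 <-> D j.+1 *m of_converse x = 0.
  by rewrite of_converse_eq0 of_converseM to_converseK.
have exE j (x : 'rV[R^c]_(n j.+2)) : x *m E j.+1 = 0 <-> exists y, y *m E j = x.
  rewrite rowE ext_vanish_columns //; split=> -[z hz].
    exists (to_converse z); apply: (can_inj (@of_converseK _ _ _)).
    by rewrite of_converseM !to_converseK.
  by exists (of_converse z); rewrite -hz of_converseM to_converseK.
have [K [i [inj ie]]] :=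
  kernel_exists (mulmxr (E 0%N) : {linear 'rV[R^c]_(n 1%N) -> 'rV[R^c]_(n 2%N)}).
have /fg_cover[k [p sp]] := noetherian_rV noethRc inj.
pose Z : 'M[R^c]_(k, n 1%N) := lin1_mx (i \o p).
have hZ (c : 'rV[R^c]_k) : c *m Z = i (p c) by rewrite mul_rV_lin1.
have kerZ (y : 'cV[R]_(n 1%N)) : D 1%N *m y = 0 <-> exists c, of_converse Z *m c = y.
  rewrite -[y]to_converseK -rowE (ie (to_converse y)); split=> [[x hx]|[c hc]].
    have [c hc] := sp x; exists (of_converse c).
    by rewrite -of_converseM hZ hc hx.
  exists (p (to_converse c)); rewrite -hZ; apply: (can_inj (@of_converseK _ _ _)).
  by rewrite of_converseM to_converseK hc.
exists k, (of_converse Z); split=> // u s r Ss uZ.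
have [reg _ _ _] := oreS; have [ls _] := reg s Ss.
have entry (v : 'rV[R]_(n 1%N)) (x : 'rV[R^c]_(n 1%N)) :
    (v *m of_converse x) 0 0 = (x *m to_converse v) 0 0.
  by rewrite -[v in LHS]to_converseK -of_converseM [LHS]mxE.
(* Division by [s] is well posed: a value exists since [u *m Z = s *: r], and is unique since [s] is
   regular. *)
have [|||f hf] := @linear_of_relation R^c K R^c^o
    (fun x a => s * a = (i x *m to_converse u) 0 0).
- move=> x; have [c <-] := sp x; exists ((r *m of_converse c) 0 0).
  by rewrite -entry -hZ of_converseM mulmxA uZ -scalemxAl [RHS]mxE.
- by move=> b; rewrite linear0 mul0mx mxE => h; apply: ls; rewrite h mulr0.
- move=> a x x' b b' hb hb'; rewrite linearP mulmxDl -scalemxAl !mxE.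
  rewrite mxE in hb; rewrite mxE in hb'; rewrite -hb -hb'.
  by change (s * ((b : R) * (a : R) + (b' : R)) =
    s * (b : R) * (a : R) + s * (b' : R)); rewrite mulrDr mulrA.
have [y hy] := syzygy_functional noethRc bound exE f inj (fun x => ie x).
exists (of_converse y).
have h0 (c : 'cV[R]_k) : (u - s *: of_converse y) *m of_converse Z *m c = 0.
  rewrite -[c]to_converseK -mulmxA -of_converseM hZ; apply: mx11_eq.
  rewrite mulmxBl -scalemxAl; have := hf (p (to_converse c)); rewrite hy -entry.
  by rewrite -[y in X in s * X]of_converseK -entry !mxE => ->; rewrite subrr.
apply/rowP => j; have := h0 (delta_mx j 0); rewrite -colE => /matrixP/(_ 0 0).
by rewrite !mxE.
Qed.

(* The cokernel Ext^1(M, R) of Hom(F_0, R) -> Hom(Omega, R) is S-torsion. *)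
Lemma ore_columns k (Z : 'M[R]_(n 1%N, k)) : torsion S M -> D 1%N *m Z = 0 ->
  exists t W, S t /\ Z *m t%:M = D 0%N *m W.
Proof.
move=> tM DZ.
have [s [Ss hs]] := common_annihilator oreS [seq e (delta_mx 0 i) | i : 'I_(n 0%N)] tM.
have /choice[v hv] (i : 'I_(n 0%N)) :
    exists v : 'rV[R]_(n 1%N), v *m D 0%N = s *: delta_mx 0 i.
  by apply/e0; rewrite linearZ; apply: hs; apply/mapP; exists i => //; rewrite mem_enum.
(* As s kills the generators of M, s times each basis row lies in the image of D_0; the rows of [U]
   are chosen preimages. *)
pose U := \matrix_i v i.
have UD : U *m D 0%N = s%:M.
  by apply/row_matrixP => i; rewrite row_mul rowK hv -scalemx1 linearZ /= row1.
(* The denominator is wanted on the right of U Z, hence the Ore condition over R^c; read back in R,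
   this is s W = U Z t. *)
have [t [W' [St tW]]] :=
  ore_common_denominator_mx (ore_set_converse oreS) (to_converse (U *m Z)) Ss.
pose W := of_converse W'.
have sW : s *: W = U *m Z *m t%:M.
  have /(congr1 (@of_converse R _ _)) := tW; rewrite -mul_scalar_mx !of_converseM.
  by rewrite !of_converse_scalar to_converseK mul_scalar_mx.
exists t, W; split=> //; apply: mulmx_rows_ext => u.
(* With s' (u D_0) = b s, the row s' u - b U lies in the kernel of D_0, the image of D_1, which Z
   kills. So s' u Z t = b U Z t = b s W = s' u D_0 W, and s' cancels. *)
have [s' [b [Ss' e']]] := ore_common_denominator_mx oreS (u *m D 0%N) Ss.
have /eS[w hw] : (s' *: u - b *m U) *m D 0%N = 0.
  by rewrite mulmxBl -scalemxAl e' -mulmxA UD subrr.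
have e2 : s' *: (u *m Z) = b *m U *m Z.
  apply/eqP; rewrite -subr_eq0 scalemxAl -mulmxBl -hw -mulmxA DZ mulmx0 //.
apply/eqP; rewrite -subr_eq0; apply/eqP; apply: (scale_mx_reg oreS Ss').
rewrite scalerBr !mulmxA [s' *: (u *m Z *m _)]scalemxAl e2.
rewrite scalemxAl e' -!mulmxA mul_scalar_mx sW !mulmxA subrr //.
Qed.

End FreeResolution.

(* P = R^k / R^k t, and M -> P is induced by x |-> x W. The first syzygy K of the
   cokernel N is the image of (t; W), with relations the image of (-Z, D_0); as the
   columns of Z generate the 1-cocycles, Ext^2(N, R) = Ext^1(K, R) = 0. *)
Lemma in_C_embedding M : in_C S M ->
  exists (P N : lmodType R) (f : {linear M -> P}) (g : {linear P -> N}),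
  [/\ ses f g, in_P S P & in_C S N].
Proof.
move=> CM; have /(in_C_ext_vanish _ noethR)[MM vM] := CM; have [fM tM] := MM.
have [n [D [e [se e0 eS]]]] := free_resolution noethR fM.
have [k [Z [kerZ refl]]] := dual_syzygy_generators se e0 eS vM.
have DZ : D 1%N *m Z = 0.
  by apply: mulmx_columns_ext => c; rewrite mul0mx -mulmxA; apply/kerZ; exists c.
have DD : D 1%N *m D 0%N = 0 := resolution_mul0 eS 0.
have [t [W [St tW]]] := ore_columns e0 eS tM DZ.
have [P [p [hP sp pe]]] := in_P_free_quotient oreS k St.
pose mW : {linear 'rV[R]_(n 0%N) -> 'rV[R]_k} := mulmxr W.
have [|f hf] := factor_surjective (g := (p \o mW : {linear 'rV[R]_(n 0%N) -> P})) se.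
  move=> x /e0[y <-] /=; apply/pe; exists (y *m Z).
  by rewrite -!mulmxA tW.
(* If y W = r t and s y = u D_0, then u Z = s r by regularity of t, and reflexivity gives v with (u
   - s v) Z = 0. The columns of D_0 are combinations of those of Z, so (u - s v) D_0 = 0, whence y =
   v D_0. *)
have f0 x : f x = 0 -> x = 0.
  have [y <-] := se x; rewrite hf /= => /pe[r hr].
  have [s [Ss hs]] := tM (e y).
  have /e0[u hu] : e (s *: y) = 0 by rewrite linearZ.
  have uZ : u *m Z = s *: r.
    apply/eqP; rewrite -subr_eq0; apply/eqP/(mulmx_scalar_reg oreS St).
    by rewrite mulmxBl -mulmxA tW mulmxA hu -!scalemxAl hr subrr.
  have [v hv] := refl u s r Ss uZ.
  have : (u - s *: v) *m D 0%N = 0.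
    apply: mulmx_columns_ext => c; rewrite mul0mx -mulmxA.
    have /kerZ[c' <-] : D 1%N *m (D 0%N *m c) = 0 by rewrite mulmxA DD mul0mx.
    by rewrite mulmxA hv mul0mx.
  rewrite mulmxBl hu -scalemxAl -scalerBr => /(scale_mx_reg oreS Ss)/eqP.
  by rewrite subr_eq0 => /eqP ->; apply/e0; exists v.
have fi := linear_injective f0.
have [N [g [sg fg]]] := cokernel_exists f.
have hfg : ses f g by [].
exists P, N, f, g; split=> //; apply/(in_C_ext_vanish _ noethR); have [MP _] := hP.
split; first exact: in_M_quotient sg MP.
have /in_P_ext_vanish[_ vP] := hP.
(* For j at least 3, Ext^j(N, R) lies between Ext^(j-1)(M, R) and Ext^j(P, R); only Ext^2(N, R)
   remains. *)
case=> [|i]; last first.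
  exact: ext_vanish_quotient hfg (in_M_resolvable noethR MM) (in_M_resolvable noethR MP)
    (vM i) (vP i.+1 R^o).
have [K [j [ij je]]] := kernel_exists (g \o p : {linear 'rV[R]_k -> N}).
have jg : ses j (g \o p : {linear 'rV[R]_k -> N}).
  by split=> // y; have [x <-] := sg y; have [z <-] := sp x; exists z.
have fgK := noetherian_rV noethR ij.
apply: ext_vanish_shift jg (@projective_rV R k) (resolvable_fg noethR fgK) _.
pose Q : lmodType R := ('rV[R]_k * 'rV[R]_(n 0%N))%type.
have [b hb] : exists b : {linear Q -> 'rV[R]_k}, forall x y, b (x, y) = x *m t%:M + y *m W.
  by exists ((mulmxr t%:M \o fst) \+ (mulmxr W \o snd) : {linear Q -> 'rV[R]_k}).
have pt (x : 'rV[R]_k) : p (x *m t%:M) = 0 by apply/pe; exists x.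
have [|q hq] := factor_injective (g := b) ij.
  case=> x y; apply/je; rewrite hb /= linearD pt add0r.
  by have /= <- := hf y; exact: exact_comp0 fg.
have [L [l [il le]]] := kernel_exists q.
have sq : surj q.
  move=> x; have /fg[m hm] : g (p (j x)) = 0 by exact: exact_comp0 x je.
  have [y hy] := se m.
  have /pe[z hz] : p (j x - y *m W) = 0.
    by have /= := hf y; rewrite linearB => <-; rewrite hy hm subrr.
  by exists (z, y); apply: ij; rewrite hq hb hz subrK.
have lq : ses l q by [].
apply: ext1_vanish_presentation lq
  (projective_pair (@projective_rV R k) (@projective_rV R (n 0%N))) _ => h.
have lE (x : L) : exists u, l x = (- (u *m Z), u *m D 0%N).
  case E : (l x) => [x1 x2].
  have e1 : x1 *m t%:M + x2 *m W = 0.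
    by rewrite -hb -E -hq (exact_comp0 _ le) linear0.
  have /e0[u hu] : e x2 = 0.
    apply: f0; rewrite hf /=; move/eqP: e1; rewrite addrC addr_eq0 => /eqP ->.
    by rewrite linearN pt oppr0.
  exists u; rewrite -hu; congr pair.
  apply/eqP; rewrite -subr_eq0 opprK; apply/eqP/(mulmx_scalar_reg oreS St).
  by rewrite mulmxDl -mulmxA tW mulmxA hu.
have [m hm] : exists m : {linear 'rV[R]_(n 1%N) -> Q}, forall u, m u = (- (u *m Z), u *m D 0%N).
  apply: linear_bundle => a u v; rewrite !mulmxDl -!scalemxAl opprD -scalerN; reflexivity.
have [|lam hlam] := factor_injective (g := m) il.
  move=> u; apply/le; apply: ij; rewrite hq hm hb linear0 mulNmx -!mulmxA tW addNr //.
have [y hy] := functional_column (h \o lam).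
(* [lam] vanishes on the image of D_1, so y is a cocycle and y = Z c; the sign in (- (u Z), u D_0)
   makes - c on the first factor the extension of [h]. *)
have /kerZ[c hc] : D 1%N *m y = 0.
  apply: mulmx_rows_ext => v; rewrite mulmx0; apply: mx11_eq; rewrite mulmxA -hy mxE /=.
  rewrite -(linear0 h); congr (h _); apply: il.
  by rewrite hlam hm -!mulmxA DZ DD !mulmx0 oppr0 linear0.
have [h1 hh1] := column_functional c.
exists ((\- h1) \o fst : {linear Q -> R^o}) => x.
have [u hu] := lE x.
have -> : x = lam u by apply: il; rewrite hlam hm.
have /= -> := hy u; rewrite hlam hm /= linearN opprK hh1.
by rewrite -mulmxA hc.
Qed.

End EmbeddingOfC.

(** * Pushout of two embeddings and cokernels of composites *)

Section MoreExactSequences.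
Variable R : pzRingType.
Implicit Types A B C D K L M N P Q X : lmodType R.

Lemma ses_pushout A B B' C C' (f : {linear A -> B}) (g : {linear B -> C})
    (f' : {linear A -> B'}) (g' : {linear B' -> C'}) :
  ses f g -> ses f' g' ->
  exists (X : lmodType R) (k : {linear B' -> X}) (q : {linear X -> C})
     (k' : {linear B -> X}) (q' : {linear X -> C'}), ses k q /\ ses k' q'.
Proof.
move=> h h'; have [X [i [q [j [iq com gen rel]]]]] := pushout_ses f' h.
have [fi _ _] := h; have [fi' fg' gs'] := h'.
have [|||q' hq'] := @linear_of_relation R X C'
    (fun x c => exists a b, x = i a + j b /\ c = g' a).
- by move=> x; have [a [b ->]] := gen x; exists (g' a), a, b.
- move=> c [a [b [/esym/rel[x [-> _]] ->]]].
  by rewrite linearN (exact_comp0 _ fg') oppr0.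
- move=> k x x' c c' [a [b [-> ->]]] [a' [b' [-> ->]]].
  by exists (k *: a + a'), (k *: b + b'); rewrite !linearP scalerDr addrACA.
exists X, i, q, j, q'; split=> //; split.
- apply: linear_injective => b jb.
  have [|x [e ->]] := rel 0 b; first by rewrite linear0 add0r.
  rewrite (_ : x = 0) ?linear0 //; apply: fi'; apply/eqP.
  by rewrite linear0 -oppr_eq0 -e.
- move=> x; have [a [b [-> ->]]] := hq' x; rewrite fg'; split=> [[y <-]|[b' e]].
    by exists (f y + b); rewrite linearD com.
  have [|y [-> _]] := rel a (b - b'); first by rewrite linearB addrA -e subrr.
  by exists (- y); rewrite linearN.
- move=> c; have [a <-] := gs' c; exists (i a).
  have [a' [b [e ->]]] := hq' (i a).
  have [|y [e' _]] := rel (a' - a) b; first by rewrite linearB addrAC -e subrr.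
  by apply/eqP; rewrite -subr_eq0 -linearB e' linearN (exact_comp0 _ fg') oppr0.
Qed.

(** Y is Q modulo the image of A; it contains C, that is B/A, with cokernel D, that is Q/B. *)
Lemma ses_cokernel_comp A B C D Q (f : {linear A -> B}) (g : {linear B -> C})
    (a : {linear B -> Q}) (b : {linear Q -> D}) :
  ses f g -> ses a b ->
  exists (Y : lmodType R) (af : {linear A -> Q}) (c : {linear Q -> Y})
    (u : {linear C -> Y}) (v : {linear Y -> D}), ses af c /\ ses u v.
Proof.
move=> [fi fg sg] [ai ab sb].
have [Y [c [sc ce]]] := cokernel_exists (a \o f : {linear A -> Q}).
have [|v hv] := factor_surjective (g := b) sc.
  by move=> x /ce[y <-]; exact: exact_comp0 ab.
have [|u hu] := factor_surjective (g := (c \o a : {linear B -> Y})) sg.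
  by move=> x /fg[y <-]; apply/ce; exists y.
exists Y, (a \o f : {linear A -> Q}), c, u, v; split; first by split=> // x y /ai/fi.
split.
- apply: linear_injective => z; have [x <-] := sg z.
  by rewrite hu => /ce[y /ai <-]; exact: exact_comp0 fg.
- move=> y; have [x <-] := sc y; rewrite hv; split=> [/ab[m <-]|[z e]].
    by exists (g m); rewrite hu.
  move: e; have [m <-] := sg z; rewrite hu /= => /eqP.
  rewrite eq_sym -subr_eq0 -linearB => /eqP/ce[y' /= e].
  by rewrite -[x](subrK (a m)) -e linearD !(exact_comp0 _ ab) addr0.
- by move=> z; have [x <-] := sb z; exists (c x).
Qed.

End MoreExactSequences.

(** * The one-step shifts F^<1> and F^<-1> *)

Section QuasiFitting.
Variables (R : pzRingType) (S : set R) (d : int) (Omega : monoidType).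
Hypothesis noethR : left_noetherian R.
Hypothesis noethRc : left_noetherian R^c.
Hypothesis oreS : ore_set S.
Hypothesis bound : forall M : lmodType R^c, finitely_generated M -> (pdstar M <= d%:E)%E.
Hypothesis mulC : forall x y : Omega, (x * y = y * x)%g.
Implicit Types A B M N P Q : objC S.
Implicit Types F G : objC S -> Omega.

Local Open Scope group_scope.

Lemma is_unit_cancel (x a b : Omega) : is_unit x -> x * a = x * b -> a = b.
Proof. by move=> [y [_ yx]] /(congr1 (fun z => y * z)); rewrite !mulgA yx !mul1g. Qed.

Lemma mul_left_comm (x y z : Omega) : x * (y * z) = y * (x * z).
Proof. by rewrite !mulgA [x * y]mulC. Qed.

Lemma unit_inv_eq (x y : Omega) : x * y = 1 -> unit_inv x = y.
Proof.
move=> xy; apply: xget_unique => [|z [xz zx]]; first by split; rewrite // mulC.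
by rewrite -[z]mulg1 -xy mulgA zx mul1g.
Qed.

Lemma objC_zero : exists2 Z : objC S, in_P S Z & forall x : Z, x = 0%R.
Proof.
have z0 (x : 'rV[R]_0) : x = 0%R by exact: thinmx0.
have hZ := in_P_zero oreS (M := 'rV[R]_0) z0.
by exists (ObjC (in_P_in_C noethR hZ)).
Qed.

(** In 0 -> Z -> Z -> Z -> 0 rule (ii) gives F Z = F Z * F Z, and F Z is a unit. *)
Lemma quasi_fitting_zero F (Z : objC S) : quasi_fitting F ->
  in_P S Z -> (forall x : Z, x = 0%R) -> F Z = 1.
Proof.
move=> [F1 F2 _] hZ z0; apply: (is_unit_cancel (F1 _ hZ)); rewrite mulg1.
apply/esym/F2 => //; exists \0%R, \0%R; split.
- by move=> x y _; rewrite (z0 x) (z0 y).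
- by move=> y; split=> // _; exists 0%R; rewrite (z0 y).
- by move=> y; exists 0%R; rewrite (z0 y).
Qed.

(** Invariance under isomorphism is not an axiom; it is rule (ii) with a zero third term. *)
Lemma quasi_fitting_iso F A B (f : {linear A -> B}) : quasi_fitting F ->
  injective f -> surj f -> F A = F B.
Proof.
move=> hF fi fs; have [Z hZ z0] := objC_zero; have [_ F2 _] := hF.
rewrite (F2 A B Z hZ) ?(quasi_fitting_zero hF hZ z0) ?mul1g //.
exists f, \0%R; split=> //; last by move=> y; exists 0%R; rewrite (z0 y).
Qed.

(** [G] is F^<1>: the relation G M = F(P)^-1 F(N) is written without the inverse and for all
    sequences at once, which includes independence of the choice. *)
Definition right_shift F G : Prop :=
  forall N P M, in_P S P -> short_exact N P M -> F N = F P * G M.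

Definition left_shift F G : Prop :=
  forall M P N, in_P S P -> short_exact M P N -> F N = F P * G M.

Lemma right_shift_inverse F G P : quasi_fitting F -> right_shift F G ->
  in_P S P -> F P * G P = 1.
Proof.
move=> hF FG hP; have [Z hZ z0] := objC_zero.
rewrite -(FG Z P P hP) ?(quasi_fitting_zero hF hZ z0) //.
exists \0%R, idfun; split; last by move=> y; exists y.
- by move=> x y _; rewrite (z0 x) (z0 y).
- by move=> y; split=> [/= ->|[x <-]] //; exists 0%R.
Qed.

Lemma left_shift_inverse F G P : quasi_fitting F -> left_shift F G ->
  in_P S P -> F P * G P = 1.
Proof.
move=> hF FG hP; have [Z hZ z0] := objC_zero.
rewrite -(FG P P Z hP) ?(quasi_fitting_zero hF hZ z0) //.
exists idfun, \0%R; split=> //; last by move=> y; exists 0%R; rewrite (z0 y).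
by move=> y; split=> // _; exists y.
Qed.

(** Multiplying a rule for [G] by F P, the inverse of G P, gives the form of the last two
    hypotheses, directly comparable with identities for F. *)
Lemma quasi_fitting_of_inverse F G : quasi_fitting F ->
  (forall P, in_P S P -> F P * G P = 1) ->
  (forall M' M P, in_P S P -> short_exact M' M P -> G M' = F P * G M) ->
  (forall P M M', in_P S P -> short_exact P M M' -> G M' = F P * G M) ->
  quasi_fitting G.
Proof.
move=> [F1 _ _] FG G2 G3; split.
- by move=> P hP; exists (F P); rewrite /is_inverse mulC FG.
- by move=> M' M P hP /G2 -> //; rewrite mulgA [G P * _]mulC FG // mul1g.
- by move=> M' M P hP /G3 -> //; rewrite mulgA [G _ * _]mulC FG // mul1g.
Qed.

Lemma right_shift_exists F : quasi_fitting F ->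
  exists2 G, quasi_fitting G & right_shift F G.
Proof.
move=> hF; have [F1 F2 F3] := hF.
have /choice[G FG] M : exists w, forall N P, in_P S P -> short_exact N P M -> F N = F P * w.
  have [N0 [P0 [f0 [g0 [e0 hP0 CN0]]]]] := in_C_cover oreS noethR (objC_in M).
  pose P0' := ObjC (in_P_in_C noethR hP0); pose N0' := ObjC CN0.
  have [u [Pu uP]] := F1 P0' hP0.
  exists (u * F N0') => N P hP [f [g fg]].
  have [X [k [q [k' [p [kq k'p]]]]]] := ses_pullback fg e0.
  pose X' := ObjC (in_C_extension oreS noethR kq (objC_in N) (in_P_in_C noethR hP0)).
  have e1 := F2 N X' P0' hP0 (ex_intro _ k (ex_intro _ q kq)).
  have e2 := F2 N0' X' P hP (ex_intro _ k' (ex_intro _ p k'p)).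
  apply: (is_unit_cancel (F1 P0' hP0)).
  by rewrite -e1 e2 [F P0' * (_ * _)]mul_left_comm [F P0' * (_ * _)]mulgA Pu mul1g.
have FG' : right_shift F G by move=> N P M; apply: FG.
exists G => //; apply: (quasi_fitting_of_inverse hF).
- by move=> P; exact: right_shift_inverse.
(* With Q covering M, the preimage L of M' is the kernel of Q -> P, hence in P, and covers M' with
   the same kernel N. *)
- move=> M' M P hP [f [g fg]].
  have [N [Q [a [b [ab hQ CN]]]]] := in_C_cover oreS noethR (objC_in M).
  have [L [i [c [j [q [ic jq _ _]]]]]] := ses_kernel_comp ab fg.
  have hL := in_P_kernel noethR ic hQ hP.
  pose Q' := ObjC (in_P_in_C noethR hQ); pose N' := ObjC CN.
  pose L' := ObjC (in_P_in_C noethR hL).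
  have e1 := FG' N' Q' M hQ (ex_intro _ a (ex_intro _ b ab)).
  have e2 := FG' N' L' M' hL (ex_intro _ j (ex_intro _ q jq)).
  have e3 := F2 L' Q' P hP (ex_intro _ i (ex_intro _ c ic)).
  apply: (is_unit_cancel (F1 L' hL)).
  by rewrite -e2 e1 e3 -mulgA mul_left_comm.
(* Now Q covers both M and M', and the kernel L of Q -> M' is an extension of P by N. *)
- move=> P M M' hP [f [g fg]].
  have [N [Q [a [b [ab hQ CN]]]]] := in_C_cover oreS noethR (objC_in M).
  have [L [i [c [j [q [ic jq _ _]]]]]] := ses_kernel_comp ab fg.
  have hL := in_C_kernel noethR ic (in_P_in_C noethR hQ) (objC_in M').
  pose Q' := ObjC (in_P_in_C noethR hQ); pose N' := ObjC CN; pose L' := ObjC hL.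
  have e1 := FG' N' Q' M hQ (ex_intro _ a (ex_intro _ b ab)).
  have e2 := FG' L' Q' M' hQ (ex_intro _ i (ex_intro _ c ic)).
  have e3 := F2 N' L' P hP (ex_intro _ j (ex_intro _ q jq)).
  apply: (is_unit_cancel (F1 Q' hQ)).
  by rewrite -e2 e3 e1 mul_left_comm.
Qed.

Lemma left_shift_exists F : quasi_fitting F ->
  exists2 G, quasi_fitting G & left_shift F G.
Proof.
move=> hF; have [F1 F2 F3] := hF.
have embed := in_C_embedding noethR noethRc oreS bound.
have /choice[G FG] M : exists w, forall P N, in_P S P -> short_exact M P N -> F N = F P * w.
  have [P0 [N0 [f0 [g0 [e0 hP0 CN0]]]]] := embed _ (objC_in M).
  pose P0' := ObjC (in_P_in_C noethR hP0); pose N0' := ObjC CN0.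
  have [u [Pu uP]] := F1 P0' hP0.
  exists (u * F N0') => P N hP [f [g fg]].
  have [X [k [q [k' [q' [kq k'q]]]]]] := ses_pushout e0 fg.
  pose X' := ObjC (in_C_extension oreS noethR kq (objC_in P) CN0).
  have e1 := F3 P X' N0' hP (ex_intro _ k (ex_intro _ q kq)).
  have e2 := F3 P0' X' N hP0 (ex_intro _ k' (ex_intro _ q' k'q)).
  apply: (is_unit_cancel (F1 P0' hP0)).
  by rewrite -e2 e1 [F P0' * (_ * _)]mul_left_comm [F P0' * (_ * _)]mulgA Pu mul1g.
have FG' : left_shift F G by move=> M P N; apply: FG.
exists G => //; apply: (quasi_fitting_of_inverse hF).
- by move=> P; exact: left_shift_inverse.
(* With M embedded in Q and N = Q/M, Q also contains M', and Y = Q/M' is an extension of N by P. *)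
- move=> M' M P hP [f [g fg]].
  have [Q [N [a [b [ab hQ CN]]]]] := embed _ (objC_in M).
  have [Y [af [c [u [v [ac uv]]]]]] := ses_cokernel_comp fg ab.
  pose Q' := ObjC (in_P_in_C noethR hQ); pose N' := ObjC CN.
  pose Y' := ObjC (in_C_extension oreS noethR uv (objC_in P) CN).
  have e1 := FG' M Q' N' hQ (ex_intro _ a (ex_intro _ b ab)).
  have e2 := FG' M' Q' Y' hQ (ex_intro _ af (ex_intro _ c ac)).
  have e3 := F3 P Y' N' hP (ex_intro _ u (ex_intro _ v uv)).
  apply: (is_unit_cancel (F1 Q' hQ)).
  by rewrite -e2 e3 e1 mul_left_comm.
(* Here Y = Q/P contains M' with cokernel N. It is to be a middle term for M', so it must lie in P:
   this is the use of [in_P_cokernel]. *)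
- move=> P M M' hP [f [g fg]].
  have [Q [N [a [b [ab hQ CN]]]]] := embed _ (objC_in M).
  have [Y [af [c [u [v [ac uv]]]]]] := ses_cokernel_comp fg ab.
  have CY := in_C_extension oreS noethR uv (objC_in M') CN.
  have hY := in_P_cokernel noethR ac hP hQ CY.
  pose Q' := ObjC (in_P_in_C noethR hQ); pose N' := ObjC CN; pose Y' := ObjC CY.
  have e1 := FG' M Q' N' hQ (ex_intro _ a (ex_intro _ b ab)).
  have e2 := FG' M' Y' N' hY (ex_intro _ u (ex_intro _ v uv)).
  have e3 := F3 P Q' Y' hP (ex_intro _ af (ex_intro _ c ac)).
  apply: (is_unit_cancel (F1 Y' hY)).
  by rewrite -e2 e1 e3 -mulgA mul_left_comm.
Qed.

End QuasiFitting.

(** * Construction and splitting of long exact sequences *)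

Section Chains.
Variables (R : pzRingType) (S : set R).
Implicit Types A B M N P Q : objC S.

(** For n = 0 there are still two objects, X_0 and X_1, joined by an isomorphism. *)
Lemma exact_seq_one M : exists X : exact_seq S 0, X 0%N = M /\ X 1%N = M.
Proof.
pose df (i : nat) : {linear M -> M} := idfun.
have inj : injective (df 0%N) by [].
have sur : surj (df 0%N) by move=> y; exists y.
have ex i : (i < 0)%N -> exact_at 0 (df i) (df i.+1) by [].
have im i : (i <= 0)%N -> image_in_C (df i).
  by move=> _; exists M, idfun, idfun; split=> // y; exists y.
by exists (@ExactSeq R S 0 (fun=> M) df inj ex sur im).
Qed.

(** Lengthening happens at the left end: X_0 embeds in X_1, so the composite B -> X_0 -> X_1 has
    image X_0. *)
Lemma exact_seq_cons n (X : exact_seq S n) A B : short_exact A B (X 0%N) ->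
  exists Y : exact_seq S n.+1,
    [/\ Y 0%N = A, Y 1%N = B & forall i, Y i.+2 = X i.+1].
Proof.
move=> [f [g [fi fg sg]]].
pose obj i := match i with 0 => A | 1 => B | j.+2 => X j.+1 end.
pose m0 : {linear B -> X 1%N} := es_map X 0 \o g.
pose df i : {linear obj i -> obj i.+1} :=
  match i return {linear obj i -> obj i.+1} with
  | 0 => f | 1 => m0 | j.+2 => es_map X j.+1 end.
have inj0 : injective (es_map X 0) := @es_inj _ _ _ X.
have ex i : (i < n.+1)%N -> exact_at 0 (df i) (df i.+1).
  case: i => [_|[|i]]; last exact: (@es_exact _ _ _ X i.+1).
    move=> y; rewrite -(fg y) /=; split=> [|->]; last exact: linear0.
    by rewrite -(linear0 (es_map X 0)) => /inj0.
  move=> n0 y; rewrite (@es_exact _ _ _ X 0 n0 y); split=> -[x <-].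
    by have [z <-] := sg x; exists z.
  by exists (g x).
have sur k : surj (es_map X k) -> surj (df k.+1).
  case: k => // sX y; have [x <-] := sX y; have [z <-] := sg x.
  by exists z.
have im i : (i <= n.+1)%N -> image_in_C (df i).
  case: i => [_|[_|i]]; last exact: (@es_image _ _ _ X i.+1).
    by exists A, idfun, f; split=> // y; exists y.
  by exists (X 0%N), g, (es_map X 0).
by exists (@ExactSeq R S n.+1 obj df fi ex (sur n (@es_surj _ _ _ X)) im).
Qed.

Lemma resolving_seq n M :
  (forall M, exists N P, in_P S P /\ short_exact N P M) ->
  exists X : exact_seq S n, X n.+1 = M /\
    forall i, (1 <= i <= n)%N -> in_P S (X i).
Proof.
move=> cover; elim: n => [|n [X [XM XP]]].
  have [X [_ XM]] := exact_seq_one M; exists X; split=> // i.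
  by case/andP => i0 /(leq_trans i0).
have [N [P [hP NP]]] := cover (X 0%N).
have [Y [_ Y1 Y2]] := exact_seq_cons NP; exists Y; split; first by rewrite Y2.
by move=> [|[|i]] // hi; rewrite ?Y1 ?Y2 //; exact: XP.
Qed.

(** Since sequences grow on the left, M is embedded first and the induction hypothesis is used for
    the cokernel; hence the generalization over M. *)
Lemma coresolving_seq n M :
  (forall M, exists P N, in_P S P /\ short_exact M P N) ->
  exists X : exact_seq S n, X 0%N = M /\
    forall i, (1 <= i <= n)%N -> in_P S (X i).
Proof.
move=> embed; elim: n M => [|n IH] M.
  have [X [XM _]] := exact_seq_one M; exists X; split=> // i.
  by case/andP => i0 /(leq_trans i0).
have [P [N [hP MP]]] := embed M; have [X [XN XP]] := IH N; rewrite -XN in MP.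
have [Y [Y0 Y1 Y2]] := exact_seq_cons MP; exists Y; split=> //.
by move=> [|[|i]] // hi; rewrite ?Y1 ?Y2 //; exact: XP.
Qed.

Lemma image_short_exact n (X : exact_seq S n) i A B
    (p : {linear X i -> A}) (j : {linear A -> X i.+1})
    (q : {linear X i.+1 -> B}) (k : {linear B -> X i.+2}) :
  (i < n)%N ->
  surj p -> injective j -> (forall x, es_map X i x = j (p x)) ->
  surj q -> injective k -> (forall x, es_map X i.+1 x = k (q x)) ->
  short_exact A (X i.+1) B.
Proof.
move=> hi sp ji e sq ki e'; exists j, q; split=> // y.
have qy : q y = 0 <-> es_map X i.+1 y = 0.
  rewrite e'; split=> [->|]; first exact: linear0.
  by rewrite -(linear0 k) => /ki.
rewrite qy (es_exact hi y); split=> -[x <-]; first by exists (p x); rewrite e.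
by have [z <-] := sp x; exists z; rewrite e.
Qed.

End Chains.

(** * Iteration of the one-step shifts *)

Section Shift.
Variables (R : pzRingType) (S : set R) (d : int) (Omega : monoidType).
Hypothesis noethR : left_noetherian R.
Hypothesis noethRc : left_noetherian R^c.
Hypothesis oreS : ore_set S.
Hypothesis bound : forall M : lmodType R^c, finitely_generated M -> (pdstar M <= d%:E)%E.
Hypothesis mulC : forall x y : Omega, (x * y = y * x)%g.
Implicit Types A B M N P Q : objC S.
Implicit Types F G : objC S -> Omega.

Local Open Scope group_scope.

(** [T] is abstract so that one iteration serves both signs of n. Consecutive values on P are
    mutually inverse, hence alternate between F P and its inverse: this produces the exponents
    (-1)^i. *)
Lemma iterated_shift (T : (objC S -> Omega) -> (objC S -> Omega) -> Prop) F :
  (forall F, quasi_fitting F -> exists2 G, quasi_fitting G & T F G) ->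
  (forall F G P, quasi_fitting F -> T F G -> in_P S P -> F P * G P = 1) ->
  quasi_fitting F ->
  exists H : nat -> objC S -> Omega,
  [/\ H 0%N = F, forall j, quasi_fitting (H j), forall j, T (H j) (H j.+1) &
      forall j P, in_P S P ->
        H j P = exp_sign j (F P) /\ H j P * H j.+1 P = 1].
Proof.
move=> exT invT hF.
have /choice[next hnext] (u : {F | quasi_fitting F}) :
    exists v : {F | quasi_fitting F}, T (sval u) (sval v).
  by have [G hG TG] := exT _ (svalP u); exists (exist _ G hG).
pose H j := iter j next (exist _ F hF).
have inv j P : in_P S P -> sval (H j) P * sval (H j.+1) P = 1.
  by apply: invT; [exact: svalP | exact: hnext].
exists (fun j => sval (H j)); split; first by [].
- by move=> j; exact: svalP.
- by move=> j; exact: hnext.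
move=> j P hP; split; last exact: inv.
elim: j => [//|j IH]; have := inv j P hP; rewrite IH => e.
have e' := unit_inv_eq mulC e.
rewrite -e' /exp_sign /=; case: (odd j) => //=.
have [y [Fy yF]] : is_unit (F P) by have [F1 _ _] := hF; exact: F1.
by rewrite (unit_inv_eq mulC Fy) (unit_inv_eq mulC yF).
Qed.

Lemma right_shift_value n (X : exact_seq S n) (H : nat -> objC S -> Omega) :
  (forall j, quasi_fitting (H j)) -> (forall j, right_shift (H j) (H j.+1)) ->
  (forall j P, in_P S P ->
     H j P = exp_sign j (H 0%N P) /\ H j P * H j.+1 P = 1) ->
  (forall i, (1 <= i <= n)%N -> in_P S (X i)) ->
  (\big[*%g/1]_(1 <= i < n.+1) exp_sign i (H 0%N (X i))) * H 0%N (X 0%N)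
    = H n (X n.+1).
Proof.
move=> hH shH eH hX.
(* For the image A of X_j -> X_(j+1) the partial product is H_j(A). The next factor H_(j+1)(P), with
   P = X_(j+1), cancels H_j(P) in H_j(I) = H_j(P) H_(j+1)(A). *)
have main j : (j <= n)%N -> forall A (p : {linear X j -> A}) (k : {linear A -> X j.+1}),
    surj p -> injective k -> (forall x, es_map X j x = k (p x)) ->
    (\big[*%g/1]_(1 <= i < j.+1) exp_sign i (H 0%N (X i))) * H 0%N (X 0%N) = H j A.
  elim: j => [|j IH] hj A p k sp ki e.
    rewrite big_nil mul1g; apply: quasi_fitting_iso (hH _) _ sp => //.
    by move=> x y /(congr1 k); rewrite -!e => /(@es_inj _ _ _ X).
  have [I [q [l [sq li e']]]] := @es_image _ _ _ X j (ltnW hj).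
  have hP : in_P S (X j.+1) by apply: hX; rewrite hj.
  have se := image_short_exact hj sq li e' sp ki e.
  have [_ inv'] := eH j _ hP.
  rewrite big_nat_recr //= -(eH j.+1 _ hP).1 -mulgA mul_left_comm //.
  rewrite (IH (ltnW hj) I q l) // (shH j _ _ _ hP se).
  by rewrite mulgA [H j.+1 _ * _]mulC // inv' mul1g.
have [I [q [l [sq li e']]]] := @es_image _ _ _ X n (leqnn n).
rewrite (main n (leqnn n) I q l) //; apply: (quasi_fitting_iso noethR oreS (f := l)) => //.
by move=> y; have [x <-] := @es_surj _ _ _ X y; exists (q x).
Qed.

Lemma left_shift_value n (X : exact_seq S n) (H : nat -> objC S -> Omega) :
  (forall j, quasi_fitting (H j)) -> (forall j, left_shift (H j) (H j.+1)) ->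
  (forall j P, in_P S P ->
     H j P = exp_sign j (H 0%N P) /\ H j P * H j.+1 P = 1) ->
  (forall i, (1 <= i <= n)%N -> in_P S (X i)) ->
  (\big[*%g/1]_(1 <= i < n.+1) exp_sign i (H 0%N (X (n.+1 - i)%N)))
    * H 0%N (X n.+1) = H n (X 0%N).
Proof.
move=> hH shH eH hX.
(* The product starts at the right end, so [m] goes down as [j] goes up: A is the image of X_m ->
   X_(m+1), and the step to j + 1 brings in the factor at the index m + 1 for the new m. *)
have main j m : (m + j)%N = n -> forall A (p : {linear X m -> A}) (k : {linear A -> X m.+1}),
    surj p -> injective k -> (forall x, es_map X m x = k (p x)) ->
    (\big[*%g/1]_(1 <= i < j.+1) exp_sign i (H 0%N (X (n.+1 - i)%N)))
      * H 0%N (X n.+1) = H j A.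
  elim: j m => [|j IH] m hm A p k sp ki e.
    rewrite addn0 in hm; subst m.
    rewrite big_nil mul1g; apply/esym/(quasi_fitting_iso noethR oreS (f := k)) => //.
    by move=> y; have [x <-] := @es_surj _ _ _ X y; exists (p x).
  have hj : (m < n)%N by rewrite -hm addnS ltnS leq_addr.
  have [I [q [l [sq li e']]]] := @es_image _ _ _ X m.+1 hj.
  have hP : in_P S (X m.+1) by apply: hX.
  have se := image_short_exact hj sp ki e sq li e'.
  have [_ inv'] := eH j _ hP.
  have em : (n.+1 - j.+1 = m.+1)%N by rewrite subSS -hm addnS -addSn addnK.
  rewrite big_nat_recr //= em -(eH j.+1 _ hP).1 -mulgA mul_left_comm //.
  rewrite (IH m.+1 _ I q l) ?addSnnS // (shH j _ _ _ hP se).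
  by rewrite mulgA [H j.+1 _ * _]mulC // inv' mul1g.
have [I [q [l [sq li e']]]] := @es_image _ _ _ X 0%N (leq0n n).
rewrite (main n 0%N (add0n n) I q l) //; apply/esym.
apply: (quasi_fitting_iso noethR oreS (f := q)) => //.
by move=> x y /(congr1 l); rewrite -!e' => /(@es_inj _ _ _ X).
Qed.

(** That every sequence computes one and the same quasi-Fitting [G] yields well-definedness and the
    quasi-Fitting property together. *)
Lemma shift_exists F (n : int) : quasi_fitting F ->
  exists2 G, quasi_fitting G & forall M,
    (exists X : exact_seq S `|n|%N, shift_seq M X) /\
    forall X : exact_seq S `|n|%N, shift_seq M X -> shift_value F X = G M.
Proof.
move=> hF; rewrite /shift_seq /shift_value; case: (0 <= n)%R.
- have [H [H0 hH shH eH]] := iterated_shift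
    (right_shift_exists noethR oreS mulC)
    (fun F G P => @right_shift_inverse R S Omega noethR oreS F G P) hF.
  exists (H `|n|%N) => // M; split; last first.
    by move=> X [<- hX]; rewrite -H0 in eH *; exact: right_shift_value.
  apply: resolving_seq => {}M.
  have [N [P [a [b [ab hP CN]]]]] := in_C_cover oreS noethR (objC_in M).
  by exists (ObjC CN), (ObjC (in_P_in_C noethR hP)); split=> //; exists a, b.
- have [H [H0 hH shH eH]] := iterated_shift
    (left_shift_exists noethR noethRc oreS bound mulC)
    (fun F G P => @left_shift_inverse R S Omega noethR oreS F G P) hF.
  exists (H `|n|%N) => // M; split; last first.
    by move=> X [<- hX]; rewrite -H0 in eH *; exact: left_shift_value.
  apply: coresolving_seq => {}M.
  have [P [N [a [b [ab hP CN]]]]] := in_C_embedding noethR noethRc oreS bound (objC_in M).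
  by exists (ObjC (in_P_in_C noethR hP)), (ObjC CN); split=> //; exists a, b.
Qed.

End Shift.

Theorem theorem3p19 (R : pzRingType) (S : set R) (d : int)
    (Omega : monoidType) (F : objC S -> Omega) (n : int) :
  left_noetherian R -> left_noetherian R^c ->
  ore_set S ->
  (forall M : lmodType R, finitely_generated M -> (pdstar M <= d%:E)%E) ->
  (forall M : lmodType R^c, finitely_generated M -> (pdstar M <= d%:E)%E) ->
  (forall x y : Omega, (x * y = y * x)%g) ->
  quasi_fitting F ->
  shift_well_defined F n /\ quasi_fitting (shift F n).
Proof.
move=> noethR noethRc oreS _ bound mulC hF.
have [G hG GP] := shift_exists noethR noethRc oreS bound mulC n hF.
(* [shift] picks by [xget] among the values of all sequences for M, which form the singleton of G
   M. *)
suff -> : shift F n = G.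
  split=> // M; have [ex eG] := GP M; split=> // X Y hX hY.
  by rewrite (eG X hX) (eG Y hY).
apply/funext => M; have [[X hX] eG] := GP M.
apply: xget_unique; first by exists X; rewrite ?eG.
by move=> w [Y hY ->]; exact: eG.
Qed.
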